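(* Let $N$ be a simply-connected nilpotent Lie group, $\Gamma\subset N$ a co-compact lattice, and $M=\Gamma\backslash N$ the corresponding nilmanifold. If $M$ admits an invariant SKT structure, then either $M$ is a torus (i.e. $N$ is abelian) or $M$ is $2$-step nilpotent (i.e. $N$ is a $2$-step nilpotent Lie group).
   Context: A Hermitian structure on a manifold $M$ is a pair $(J,g)$ with $J$ an (integrable) complex structure and $g$ a Riemannian metric with $g(J\cdot,J\cdot)=g(\cdot,\cdot)$; its fundamental form is $\omega(\cdot,\cdot)=g(J\cdot,\cdot)$. It is called SKT (strong Kähler with torsion, or pluriclosed) if $\partial\bar\partial\omega=0$; equivalently, the torsion $3$-form of the Bismut connection (the unique connection preserving $J$ and $g$ with totally skew-symmetric torsion) is closed. A Hermitian structure on a nilmanifold $\Gamma\backslash N$ is called invariant if it is induced by a left-invariant Hermitian structure on $N$. Descending central series of a Lie algebra $\mathfrak g$: $\mathfrak g_0=\mathfrak g$, $\mathfrak g_i=[\mathfrak g,\mathfrak g_{i-1}]$. $\mathfrak g$ is $k$-step nilpotent if $\mathfrak g_k=0$ and $\mathfrak g_{k-1}\neq 0$; a Lie group is $k$-step nilpotent if its Lie algebra is. *)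

(* Defs.v *)
From HB Require Import structures.
From mathcomp Require Import all_boot all_order all_algebra.
From mathcomp Require Import all_classical all_reals all_analysis.
From mathcomp Require Import complex.

Set Implicit Arguments.
Unset Strict Implicit.
Unset Printing Implicit Defensive.

Import Order.TTheory GRing.Theory Num.Theory.
Import numFieldTopology.Exports numFieldNormedType.Exports.

Local Open Scope classical_set_scope.
Local Open Scope ring_scope.

(* [U] is meant to be open and [V] finite-dimensional: [f] is of class C^(k+1)
   when it is differentiable and all its directional derivatives are C^k. *)
Fixpoint Ck (R : realType) (V W : normedModType R) (k : nat) (U : set V)
    (f : V -> W) : Prop :=
  match k with
  | 0 => forall x, U x -> {for x, continuous f}
  | k'.+1 => (forall x, U x -> differentiable f x) /\
             (forall v, Ck k' U (fun x => 'd f x v))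
  end.

Definition smooth (R : realType) (V W : normedModType R) (U : set V)
    (f : V -> W) : Prop :=
  forall k, Ck k U f.

Record atlas (R : realType) (n : nat) (T : topologicalType) := Atlas {
  index : Type;
  dom : index -> set T;
  img : index -> set 'rV[R]_n;
  chart : index -> T -> 'rV[R]_n;
  chart_inv : index -> 'rV[R]_n -> T;
  dom_open : forall i, open (dom i);
  img_open : forall i, open (img i);
  chart_img : forall i p, dom i p -> img i (chart i p);
  chart_inv_dom : forall i x, img i x -> dom i (chart_inv i x);
  chartK : forall i p, dom i p -> chart_inv i (chart i p) = p;
  chart_invK : forall i x, img i x -> chart i (chart_inv i x) = x;
  chart_continuous : forall i p, dom i p -> {for p, continuous (chart i)};
  chart_inv_continuous :
    forall i x, img i x -> {for x, continuous (chart_inv i)};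
  chart_cover : forall p, exists i, dom i p;
  transition_smooth : forall i j,
    smooth [set x | img i x /\ dom j (chart_inv i x)]
           (fun x => chart j (chart_inv i x))
}.

HB.mixin Record isTopologicalGroup G of Topological G & Group G := {
  mulg_continuous : continuous (fun xy : G * G => (xy.1 * xy.2)%g);
  invg_continuous : continuous (fun x : G => (x^-1)%g)
}.

#[short(type="topologicalGroupType")]
HB.structure Definition TopologicalGroup :=
  {G of Topological G & Group G & isTopologicalGroup G}.

Record lieGroup (R : realType) (n : nat) := LieGroup {
  carrier :> topologicalGroupType;
  lie_hausdorff : hausdorff_space carrier;
  lie_second_countable : @second_countable carrier;
  lie_atlas : atlas R n carrier;
  mul_smooth : forall i j k : index lie_atlas,
    smooth [set xy : 'rV[R]_n * 'rV[R]_n |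
              [/\ img i xy.1, img j xy.2
                & dom k (chart_inv i xy.1 * chart_inv j xy.2)%g]]
           (fun xy => chart k (chart_inv i xy.1 * chart_inv j xy.2)%g);
  inv_smooth : forall i j : index lie_atlas,
    smooth [set x | img i x /\ dom j (chart_inv i x)^-1%g]
           (fun x => chart j (chart_inv i x)^-1%g)
}.

Definition abelian_group (G : groupType) : Prop :=
  forall x y : G, (x * y = y * x)%g.

Definition path_connected (R : realType) (T : topologicalType) : Prop :=
  forall p q : T, exists gamma : R -> T,
    [/\ {within `[0, 1], continuous gamma}, gamma 0 = p & gamma 1 = q].

Definition loops_contractible (R : realType) (T : topologicalType) : Prop :=
  forall gamma : R -> T,
    {within `[0, 1], continuous gamma} -> gamma 0 = gamma 1 ->
    exists H : R * R -> T,
      {within `[0, 1] `*` `[0, 1], continuous H} /\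
      forall t : R, 0 <= t <= 1 ->
        [/\ H (0, t) = gamma t, H (1, t) = gamma 0,
            H (t, 0) = gamma 0 & H (t, 1) = gamma 0].

Definition simply_connected (R : realType) (T : topologicalType) : Prop :=
  path_connected R T /\ loops_contractible R T.

(* Tensor fields are given by their expressions in the charts: in the chart [i]
   at the point of coordinates [x], tangent vectors are elements of ['rV[R]_n].
   Only the values at the points [x] of [img i] are meaningful. *)

Section Tensors.
Variables (R : realType) (n : nat) (N : lieGroup R n).
Local Notation V := 'rV[R]_n.
Local Notation I := (index (lie_atlas N)).

Definition rep_on (F : N -> N) (i j : I) : set V :=
  [set x | img i x /\ dom j (F (chart_inv i x))].

Definition rep (F : N -> N) (i j : I) : V -> V :=
  fun x => chart j (F (chart_inv i x)).

Definition left_mul (a : N) : N -> N := fun p => (a * p)%g.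

Definition vfield := I -> V -> V.

Definition endo_field := I -> V -> V -> V.

Definition bilinear_field := I -> V -> V -> V -> R.

(* Invariance under [F]. For [F := id] this is the rule for a change of
   charts, i.e. the condition that the local expressions define a global
   tensor field. *)
Definition vfield_invariant (F : N -> N) (X : vfield) : Prop :=
  forall i j x, rep_on F i j x ->
    X j (rep F i j x) = 'd (rep F i j) x (X i x).

Definition endo_invariant (F : N -> N) (J : endo_field) : Prop :=
  forall i j x, rep_on F i j x -> forall v,
    J j (rep F i j x) ('d (rep F i j) x v) = 'd (rep F i j) x (J i x v).

Definition bilinear_invariant (F : N -> N) (g : bilinear_field) : Prop :=
  forall i j x, rep_on F i j x -> forall u v,
    g j (rep F i j x) ('d (rep F i j) x u) ('d (rep F i j) x v) = g i x u v.

Definition is_vfield (X : vfield) : Prop :=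
  (forall i, smooth (img i) (X i)) /\ vfield_invariant id X.

Definition left_invariant_vfield (X : vfield) : Prop :=
  is_vfield X /\ forall a, vfield_invariant (left_mul a) X.

Definition local_bracket (X Y : V -> V) : V -> V :=
  fun x => 'd Y x (X x) - 'd X x (Y x).

Definition bracket (X Y : vfield) : vfield :=
  fun i => local_bracket (X i) (Y i).

Definition vfield_span (A : set vfield) : set vfield :=
  [set Z | exists (m : nat) (c : 'I_m -> R) (Y : 'I_m -> vfield),
     (forall l, A (Y l)) /\
     forall i x, img i x -> Z i x = \sum_(l < m) c l *: Y l i x].

Fixpoint descending_central_series (k : nat) : set vfield :=
  match k with
  | 0 => left_invariant_vfield
  | k'.+1 => vfield_span
      [set Z | exists X Y, [/\ left_invariant_vfield X,
                 descending_central_series k' Y & Z = bracket X Y]]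
  end.

Definition central_series_zero (k : nat) : Prop :=
  forall X, descending_central_series k X ->
    forall i x, img i x -> X i x = 0.

Definition nilpotent_lie_group : Prop := exists k, central_series_zero k.

Definition step_nilpotent (k : nat) : Prop :=
  [/\ (0 < k)%N, central_series_zero k & ~ central_series_zero k.-1].

Definition almost_complex (J : endo_field) : Prop :=
  [/\ forall i x, img i x -> linear (J i x),
      forall i v, smooth (img i) (fun x => J i x v),
      endo_invariant id J
    & forall i x, img i x -> forall v, J i x (J i x v) = - v].

(* Vanishing of the Nijenhuis tensor
   [JX, JY] - J[JX, Y] - J[X, JY] - [X, Y]. *)
Definition integrable (J : endo_field) : Prop :=
  forall (i : I) (X Y : V -> V), smooth (img i) X -> smooth (img i) Y ->
    let JX := fun x => J i x (X x) in
    let JY := fun x => J i x (Y x) in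
    forall x, img i x ->
      local_bracket JX JY x - J i x (local_bracket JX Y x)
        - J i x (local_bracket X JY x) - local_bracket X Y x = 0.

Definition riemannian_metric (g : bilinear_field) : Prop :=
  [/\ forall i x, img i x -> forall u, linear (g i x u : V -> R^o),
      forall i u v, smooth (img i) (fun x => g i x u v : R^o),
      bilinear_invariant id g,
      forall i x, img i x -> forall u v, g i x u v = g i x v u
    & forall i x, img i x -> forall v, v != 0 -> 0 < g i x v v].

Definition hermitian (J : endo_field) (g : bilinear_field) : Prop :=
  [/\ almost_complex J, integrable J, riemannian_metric g
    & forall i x, img i x -> forall u v, g i x (J i x u) (J i x v) = g i x u v].

Definition invariant_under (S : set N) (J : endo_field) (g : bilinear_field) :
    Prop :=
  forall a, S a -> endo_invariant (left_mul a) J /\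
                   bilinear_invariant (left_mul a) g.

End Tensors.

Section Forms.
Variables (R : realType) (n : nat).
Local Notation V := 'rV[R]_n.

(* Multilinearity and alternation are not part of the type. *)
Definition form (k : nat) := V -> ('I_k -> V) -> R[i].

Definition cderive (f : V -> R[i]) (x v : V) : R[i] :=
  Complex ('d (fun y => complex.Re (f y) : R^o) x v)
          ('d (fun y => complex.Im (f y) : R^o) x v).

(* Evaluation of the form on constant vector fields: the bracket terms of
   the invariant formula vanish. *)
Definition ext_d (k : nat) (alpha : form k) : form k.+1 :=
  fun x v => \sum_(l < k.+1)
    (-1) ^+ l * cderive (fun y => alpha y (fun m => v (lift l m))) x (v l).

(* The component of type (p, k - p) of a k-form: the sum, over the sets [S] of
   p slots, of the complex-multilinear extension of [alpha] evaluated on the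
   projections (v - iJv)/2 of the vectors in the slots of [S] to the (1,0)
   tangent space, and (v + iJv)/2 of the others to the (0,1) tangent space.
   [A] is the set of slots where the term in J is selected when expanding. *)
Definition type_part (J : V -> V -> V) (k p : nat) (alpha : form k) : form k :=
  fun x v => \sum_(S : {set 'I_k} | #|S| == p) \sum_(A : {set 'I_k})
    (2%:R ^+ k)^-1 *
    (\prod_(l in A) (if l \in S then - Complex 0 1 else Complex 0 1)) *
    alpha x (fun l => if l \in A then J x (v l) else v l).

(* To be applied to forms of type (p, k - p). *)
Definition del (J : V -> V -> V) (k p : nat) (alpha : form k) : form k.+1 :=
  type_part J p.+1 (ext_d alpha).

Definition delbar (J : V -> V -> V) (k p : nat) (alpha : form k) : form k.+1 :=
  type_part J p (ext_d alpha).

Definition fundamental_form (J : V -> V -> V) (g : V -> V -> V -> R) : form 2 :=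
  fun x v => Complex (g x (J x (v ord0)) (v ord_max)) 0.

End Forms.

(* The fundamental form has type (1, 1), and its image by delbar type (1, 2). *)
Definition SKT (R : realType) (n : nat) (N : lieGroup R n)
    (J : endo_field N) (g : bilinear_field N) : Prop :=
  forall i x, img i x -> forall v : 'I_4 -> 'rV[R]_n,
    del (J i) 1 (delbar (J i) 1 (fundamental_form (J i) (g i))) x v = 0.

Record subgroup (G : groupType) := Subgroup {
  subgroup_set :> set G;
  subgroup1 : subgroup_set 1%g;
  subgroupM : forall x y,
    subgroup_set x -> subgroup_set y -> subgroup_set (x * y)%g;
  subgroupV : forall x, subgroup_set x -> subgroup_set x^-1%g
}.

Section Quotient.
Variables (G : topologicalGroupType) (Gamma : subgroup G).

(* [coset_rel x y] means that the cosets Gamma x and Gamma y are equal. *)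
Definition coset_rel : rel G := fun x y => `[< subgroup_set Gamma (y * x^-1)%g >].

Lemma coset_rel_refl : reflexive coset_rel.
Proof. by move=> x; apply/asboolP; rewrite mulgV; exact: subgroup1. Qed.

Lemma coset_rel_sym : symmetric coset_rel.
Proof.
have imp x y : coset_rel x y -> coset_rel y x.
  by move=> /asboolP/subgroupV Gxy; apply/asboolP; rewrite invgM invgK in Gxy.
by move=> x y; apply/idP/idP; exact: imp.
Qed.

Lemma coset_rel_trans : transitive coset_rel.
Proof.
move=> y x z /asboolP Gxy /asboolP Gyz; apply/asboolP.
by have := subgroupM Gyz Gxy; rewrite mulgA mulgVK.
Qed.

Canonical coset_equiv :=
  EquivRel coset_rel coset_rel_refl coset_rel_sym coset_rel_trans.

Definition left_quotient : topologicalType :=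
  quotient_topology {eq_quot coset_equiv}%qT.

Definition cocompact_lattice : Prop :=
  (forall x, subgroup_set Gamma x -> isolated Gamma x) /\
  compact [set: left_quotient].

End Quotient.

(* The projection of [N] onto [left_quotient Gamma] is a local diffeomorphism,
   so the charts of the quotient are the charts of [N] on small open sets, and
   tensor fields on the quotient are the [Gamma]-invariant tensor fields on
   [N], with the same local expressions. *)
Definition quotient_hermitian (R : realType) (n : nat) (N : lieGroup R n)
    (Gamma : subgroup N) (J : endo_field N) (g : bilinear_field N) : Prop :=
  hermitian J g /\ invariant_under Gamma J g.

Definition admits_invariant_SKT (R : realType) (n : nat) (N : lieGroup R n)
    (Gamma : subgroup N) : Prop :=
  exists (J : endo_field N) (g : bilinear_field N),
    [/\ quotient_hermitian Gamma J g, invariant_under [set: N] J g & SKT J g].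

(* Main.v *)
(** At the identity, an invariant SKT structure is a complex structure [J] and an
    inner product [g] on the nilpotent Lie algebra of [N] such that the torsion
    3-form is closed.  The (2,2) part of its differential vanishes by hypothesis,
    and the other parts vanish by integrability.

    Let [D] be the adjoint map of [J X].  If [X] is central, then evaluating the
    closedness condition on [X, J X, Y, J Y] along the ascending central series
    gives [D = 0]: the center is [J]-invariant.  Suppose now that the bracket
    [[A, B]] lies in the second center, and let [X] be its component orthogonal to
    the center.  The same evaluation expresses the sum of the squares of [[X, Y]],
    [[X, J Y]], [[J X, J Y]] and [[J X, Y]] through [E = [X, J X]] and
    [F = [Y, J Y]]; comparing its growth along the orbits of [exp (t D)] gives
    [D ^ 2 = 0], then [E = 0], then [D = 0], and finally that [X] is central.
    Hence all brackets are central.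

    If all brackets vanish, then the adjoint representation has zero derivative,
    so it is trivial, since [N] is connected; thus the map sending [p] to the
    commutator of [a] and [p] has zero derivative too, and is constant. *)

From HB Require Import structures.
Require Import Defs.
From mathcomp Require Import all_boot all_order all_algebra.
From mathcomp Require Import all_classical all_reals all_analysis.
From mathcomp Require Import complex ring lra zify.

Set Implicit Arguments.
Unset Strict Implicit.
Unset Printing Implicit Defensive.

Import Order.TTheory GRing.Theory Num.Theory.
Import numFieldTopology.Exports numFieldNormedType.Exports.

Local Open Scope classical_set_scope.
Local Open Scope ring_scope.

(** * SKT structures on nilpotent Lie algebras *)

(** For [Y = U] the closedness identity equates a sum of squares with terms in [E], [D ^ 2] and
    [D F] that have no sign. When [X] is central, induction removes them all; when [X] is only in
    the second center, [g (D (D Y)) Y] is the obstacle. Replacing [Y] by [exp (t D) Y] makes both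
    sides polynomial in [t], because [D] is a nilpotent derivation commuting with [J] modulo the
    center. If [D ^ (r + 3) = 0], the right side contributes nothing in degree [2 r + 2]: [D ^ 2] of
    a bracket is orthogonal to the center, which contains [E]. On the left only non-negative terms
    remain in that degree, one of them at least the square of [D ^ (r + 2) Y]. Exponentials are
    avoided by letting [D] act on bilinear functions as a derivation, hence the polarized identity.

    On the analytic side, the real part of the (1,2)-form that [SKT] differentiates is half of the
    differential of the fundamental form, hence closed: the information lies in the imaginary part,
    which is half of the torsion. Forms are differentiated there along constant vectors of a chart,
    so a passage to left-invariant frames is needed. *)

Section HermitianLieAlgebra.
Variables (R : realFieldType) (V : vectType R).
Variables (b : V -> V -> V) (J : V -> V) (g : V -> V -> R).
Hypothesis b_linear : forall u, linear (b u).
Hypothesis bC : forall u v, b u v = - b v u.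
Hypothesis jacobi : forall u v w, b u (b v w) + b v (b w u) + b w (b u v) = 0.
Hypothesis J_linear : linear J.
Hypothesis JK : forall u, J (J u) = - u.
Hypothesis integrable : forall u v,
  b (J u) (J v) - J (b (J u) v) - J (b u (J v)) - b u v = 0.
Hypothesis g_linear : forall u, linear (g u : V -> R^o).
Hypothesis gC : forall u v, g u v = g v u.
Hypothesis g_gt0 : forall u, u != 0 -> 0 < g u u.
Hypothesis gJ : forall u v, g (J u) (J v) = g u v.

Let bDr u v w : b u (v + w) = b u v + b u w.
Proof. by have := b_linear u 1 v w; rewrite !scale1r. Qed.
Let bZr a u v : b u (a *: v) = a *: b u v.
Proof.
have b0 : b u 0 = 0.
  by have := bDr u 0 0; rewrite addr0 => /(congr1 (fun x => x - b u 0)); rewrite addrK subrr.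
by have := b_linear u a v 0; rewrite !addr0 b0 addr0.
Qed.
Let b0r u : b u 0 = 0. Proof. by rewrite -[X in b u X](scale0r (0 : V)) bZr scale0r. Qed.
Let bNr u v : b u (- v) = - b u v. Proof. by rewrite -(scaleN1r v) bZr scaleN1r. Qed.
Let bDl u v w : b (u + v) w = b u w + b v w.
Proof. by rewrite bC bDr opprD -!(bC _ w). Qed.
Let bNl u v : b (- u) v = - b u v. Proof. by rewrite bC bNr -bC. Qed.
Let b0l u : b 0 u = 0. Proof. by rewrite bC b0r oppr0. Qed.
Let JD u v : J (u + v) = J u + J v.
Proof. by have := J_linear 1 u v; rewrite !scale1r. Qed.
Let J0 : J 0 = 0.
Proof.
have /eqP := JD 0 0.
by rewrite addr0 -subr_eq0 opprD addrA subrr sub0r oppr_eq0 => /eqP.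
Qed.
Let JN u : J (- u) = - J u.
Proof. by apply/eqP; rewrite -addr_eq0 -JD addNr J0. Qed.
Let gDr u v w : g u (v + w) = g u v + g u w.
Proof. by have := g_linear u 1 v w; rewrite !scale1r. Qed.
Let g0r u : g u 0 = 0.
Proof. by have := gDr u 0 0; rewrite addr0; lra. Qed.
Let gZr a u v : g u (a *: v) = a * g u v.
Proof. by have := g_linear u a v 0; rewrite !addr0 g0r addr0. Qed.
Let gNr u v : g u (- v) = - g u v. Proof. by rewrite -(scaleN1r v) gZr mulN1r. Qed.
Let gDl u v w : g (u + v) w = g u w + g v w. Proof. by rewrite !(gC _ w) gDr. Qed.
Let gNl u v : g (- u) v = - g u v. Proof. by rewrite !(gC _ v) gNr. Qed.
Let g0l u : g 0 u = 0. Proof. by rewrite gC g0r. Qed.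
Let gZl a u v : g (a *: u) v = a * g u v. Proof. by rewrite !(gC _ v) gZr. Qed.
Let g_ge0 u : 0 <= g u u.
Proof. by case: (eqVneq u 0) => [->|/g_gt0/ltW//]; rewrite g0l. Qed.
Let g_eq0 u : g u u = 0 -> u = 0.
Proof. by case: (eqVneq u 0) => // /g_gt0 + e; rewrite e ltxx. Qed.
(** Equalities of vectors are turned by this into equalities of scalars, which [lra] and [ring] can
    settle. *)
Let gext u v : (forall w, g u w = g v w) -> u = v.
Proof.
by move=> h; apply/eqP; rewrite -subr_eq0; apply/eqP/g_eq0; rewrite gDl gNl h subrr.
Qed.
Let gJl u v : g (J u) v = - g u (J v).
Proof. by rewrite -(gJ u (J v)) JK gNr opprK. Qed.
Let gE := (gDl, gDr, gNl, gNr, g0l, g0r).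
Let bE := (bDl, bDr, bNl, bNr, b0l, b0r, JD, JN, JK, J0).

Let integ u v : b (J u) (J v) = b u v + J (b (J u) v + b u (J v)).
Proof.
apply: gext => w; have := congr1 (g^~ w) (integrable u v).
by rewrite JD !gE; lra.
Qed.

(** The torsion 3-form of the Bismut connection on left-invariant fields; it is the differential of
    the fundamental form evaluated on [J u], [J v], [J w]. *)
Definition torsion u v w :=
  - (g (b (J u) (J v)) w + g (b (J v) (J w)) u + g (b (J w) (J u)) v).

(** The Chevalley-Eilenberg differential of [torsion]. *)
Definition dtorsion u v w x :=
  - torsion (b u v) w x + torsion (b u w) v x - torsion (b u x) v w
  - torsion (b v w) u x + torsion (b v x) u w - torsion (b w x) u v.

(** Up to sign, [kappa] is the differential of the vector-valued 2-form sending [u, v] to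
    [[J u, J v]], and [quad] pairs that 2-form with the bracket. These are the two kinds of terms in
    [dtorsion], and [J] acts on each of them in a simple way. *)
Let kappa u v w := b (J (b u v)) (J w) + b (J (b v w)) (J u) + b (J (b w u)) (J v).
Let quad u v w x := g (b (J u) (J v)) (b w x) + g (b (J w) (J x)) (b u v).

Let dtorsionE u v w x : dtorsion u v w x =
  g (kappa u v w) x - g (kappa u v x) w + g (kappa u w x) v - g (kappa v w x) u
  + (quad u v w x - quad u w v x + quad u x v w).
Proof.
have torsionl p q r : torsion p q r =
    - (g (b (J p) (J q)) r + g (b (J q) (J r)) p - g (b (J p) (J r)) q).
  by rewrite /torsion (bC (J r)) gNl.
rewrite /dtorsion !torsionl /kappa /quad.
rewrite (bC x u) (bC w u) (bC x v) !bE !gE; ring.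
Qed.

(** Besides integrability, this uses the Jacobi identity twice: for [u, v, w] after applying [J],
    and for [J u, J v, J w]. *)
Let kappaJ u v w :
  kappa (J u) v w + kappa u (J v) w + kappa u v (J w) = J (kappa u v w).
Proof.
apply: gext => x; rewrite /kappa !JD.
have H p q : J (b (J p) (J q)) = J (b p q) - b (J p) q - b p (J q).
  by rewrite integ JD JK opprD addrA.
rewrite !H.
have jJ : J (b (b u v) w) + J (b (b v w) u) + J (b (b w u) v) = 0.
  rewrite -!JD (bC (b u v)) (bC (b v w)) (bC (b w u)) -!opprD.
  have -> : b w (b u v) + b u (b v w) + b v (b w u) = 0 by rewrite -(jacobi w u v).
  by rewrite oppr0 J0.
have jJJ : b (b (J u) (J v)) (J w) + b (b (J v) (J w)) (J u) + b (b (J w) (J u)) (J v) = 0.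
  rewrite (bC (b (J u) (J v))) (bC (b (J v) (J w))) (bC (b (J w) (J u))) -!opprD.
  have -> : b (J w) (b (J u) (J v)) + b (J u) (b (J v) (J w)) + b (J v) (b (J w) (J u)) = 0
    by rewrite -(jacobi (J w) (J u) (J v)).
  by rewrite oppr0.
have I p q r : b (J (b (J p) q)) (J r) + b (J (b p (J q))) (J r) =
   b (b (J p) (J q)) (J r) - b (b p q) (J r).
  by rewrite -bDl -JD -bNl -bDl (integ p q) [b p q + _]addrC addrK.
have := congr1 (g^~ x) jJ; have := congr1 (g^~ x) jJJ.
have := congr1 (g^~ x) (I u v w); have := congr1 (g^~ x) (I v w u).
have := congr1 (g^~ x) (I w u v).
rewrite !JK !bNr !gE; lra.
Qed.

Let quadJ u v w x :
  quad (J u) v w x + quad u (J v) w x + quad u v (J w) x + quad u v w (J x) = 0.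
Proof.
have sk p q : g (J p) q = - g (J q) p by rewrite gJl gC.
rewrite /quad !JK !bNl !bNr !(integ u v) !(integ w x) !bE !gE.
rewrite !(sk (b (J w) x)) !(sk (b w (J x))).
rewrite !(gC (b w (J x))) !(gC (b (J w) x)) !(gC (b w x));  lra.
Qed.

(** The derivation induced by [J] multiplies a form of type (p, q) by a multiple of p - q, so its
    vanishing on a 4-form says that the form has pure type (2,2). *)
Let dtorsion_pure u v w x :
  dtorsion (J u) v w x + dtorsion u (J v) w x + dtorsion u v (J w) x
  + dtorsion u v w (J x) = 0.
Proof.
rewrite !dtorsionE.
have k p q r s : g (kappa (J p) q r) s + g (kappa p (J q) r) s +
    g (kappa p q (J r)) s + g (kappa p q r) (J s) = 0.
  by rewrite -!gDl kappaJ gJl addNr.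
have := k u v w x; have := k u v x w; have := k u w x v; have := k v w x u.
have := quadJ u v w x; have := quadJ u w v x; have := quadJ u x v w; lra.
Qed.

(* Vanishing of the (2,2) part of the 4-form [dtorsion]. *)
Hypothesis dtorsion_22 : forall u v w x,
  6%:R * dtorsion u v w x
  + 2%:R * (dtorsion (J u) (J v) w x + dtorsion (J u) v (J w) x
            + dtorsion (J u) v w (J x) + dtorsion u (J v) (J w) x
            + dtorsion u (J v) w (J x) + dtorsion u v (J w) (J x))
  + 6%:R * dtorsion (J u) (J v) (J w) (J x) = 0.

(** Let [d] be the value and [S] the sum of the six values with [J] in two slots. Summing
    [dtorsion_pure] over one [J] already inserted gives [2 S = 4 d]; over three [J] inserted, it
    shows that the value with four [J] is [S / 2 = d]. The hypothesis then reads [16 d = 0]. *)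
Let dtorsion0 u v w x : dtorsion u v w x = 0.
Proof.
have N1 p q r s : dtorsion (- p) q r s = - dtorsion p q r s.
  by rewrite /dtorsion /torsion !bE !gE; ring.
have N2 p q r s : dtorsion p (- q) r s = - dtorsion p q r s.
  by rewrite /dtorsion /torsion !bE !gE; ring.
have N3 p q r s : dtorsion p q (- r) s = - dtorsion p q r s.
  by rewrite /dtorsion /torsion !bE !gE; ring.
have N4 p q r s : dtorsion p q r (- s) = - dtorsion p q r s.
  by rewrite /dtorsion /torsion !bE !gE; ring.
have := dtorsion_22 u v w x.
have := dtorsion_pure (J u) v w x; have := dtorsion_pure u (J v) w x.
have := dtorsion_pure u v (J w) x; have := dtorsion_pure u v w (J x).
have := dtorsion_pure (J u) (J v) (J w) x; have := dtorsion_pure (J u) (J v) w (J x).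
have := dtorsion_pure (J u) v (J w) (J x); have := dtorsion_pure u (J v) (J w) (J x).
rewrite !JK !(N1, N2, N3, N4); lra.
Qed.

Let leibniz u v w : b u (b v w) = b (b u v) w + b v (b u w).
Proof.
apply: gext => x; have := congr1 (g^~ x) (jacobi u v w).
by rewrite (bC w u) (bC w (b u v)) !bE !gE; lra.
Qed.

(** * The closedness identity on [X], [J X], [Y], [J U] *)

Section Polarized.
Variables (X Y U : V).
Hypothesis bX_central : forall v w, b (b X v) w = 0.
Hypothesis JbX_central : forall v w, b (J (b X v)) w = 0.
Hypothesis bX_perp : forall v, [/\ g (b X v) X = 0, g (b X v) Y = 0 & g (b X v) U = 0].
Hypothesis bX_perpJ :
  forall v, [/\ g (b X v) (J X) = 0, g (b X v) (J Y) = 0 & g (b X v) (J U) = 0].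

(** Half the sum of the closedness conditions on [X, J X, Y, J U] and on [X, J X, U, J Y].
    Symmetrizing makes the right side depend on the brackets of [Y] and [U] only through
    [b Y (J U) + b U (J Y)]. *)
Lemma polarized_identity :
  g (b X Y) (b X U) + g (b X (J Y)) (b X (J U))
  + g (b (J X) (J Y)) (b (J X) (J U)) + g (b (J X) Y) (b (J X) U) =
  g (b X (J X)) (b Y (J U) + b U (J Y))
  - g (b (J X) (b (J X) Y)) U - g Y (b (J X) (b (J X) U))
  - g (b (J X) (b Y (J U) + b U (J Y))) X.
Proof.
(* The adjoint map of [J X] is made opaque, so that the rewriting rules for [b] leave it alone. *)
have [D DE] : exists D : V -> V, forall v, b (J X) v = D v by exists (b (J X)).
have DD v w : D (v + w) = D v + D w by rewrite -!DE bDr.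
have DC v : b v (J X) = - D v by rewrite bC DE.
have DJ v : D (J v) = J (D v) + (b X v + J (b X (J v))).
  by rewrite -!DE integ JD addrCA.
have cX v w : b w (b X v) = 0 by rewrite bC bX_central oppr0.
have cJX v w : b w (J (b X v)) = 0 by rewrite bC JbX_central oppr0.
have DJb v w : b w (D (J v)) = b w (J (D v)) by rewrite DJ !bDr cX cJX !addr0.
have Dc v : D (b X v) = 0 by rewrite -DE cX.
have DJc v : D (J (b X v)) = 0 by rewrite -DE cJX.
have DJD v : D (J (D v)) = D (D (J v)) by rewrite [in RHS]DJ !DD Dc DJc !addr0.
have K1 W A : (forall v, g (b X v) A = 0) -> (forall v, g (b X v) (J A) = 0) ->
    g (D (J W)) (J A) = g (D W) A.
  by move=> h1 h2; rewrite DJ gDl gDl gJ gJ h2 h1 !addr0.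
have DJDJ A B : (forall v, g (b X v) A = 0) -> g (D (J (D (J B)))) A = - g (D (D B)) A.
  by move=> h; rewrite DJD JK -!DE !bNr gNl.
have JDX w : b (J (D X)) w = 0.
  by have := JbX_central (J X) w; rewrite DC JN bNl => /eqP; rewrite oppr_eq0 => /eqP.
have JDJ B w : b (J (D (J B))) w = - b (D B) w.
  rewrite DJ !JD JK !bDl JbX_central JK bNl bNl bX_central.
  by rewrite oppr0 !addr0.
have k1 A B : (forall v, g (b X v) A = 0) -> (forall v, g (b X v) B = 0) ->
    (forall v, g (b X v) (J B) = 0) -> (forall v, g (b X v) X = 0) ->
    (forall v, g (b X v) (J X) = 0) ->
   dtorsion X (J X) A (J B) =
   - g (D (D A)) B - g (D (D B)) A - g (D (b A (J B))) X
   + g (b (J (D A)) B) X - g (b (D B) (J A)) X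
   + g (b X (J X)) (b A (J B)) + g (b B (J A)) (b X (J X))
   - g (b (J X) (J A)) (b (J X) (J B)) - g (b X B) (b X A)
   - g (b (J X) A) (b (J X) B) - g (b X (J A)) (b X (J B)).
  move=> hA hB hJB hX hJX; rewrite dtorsionE /quad /kappa !JK.
  rewrite (bC A X) (bC (J B) X) (bC (J B) (J X)) !bE !gE !DE !DC.
  rewrite !JbX_central !JN !bNl !JDX !JDJ !gE DJDJ // !K1 // (bC (J (b A (J B))) X).
  rewrite (bC (J A) B) !gE !hX (gC (b X B)) (gC (D B)); lra.
(* By the Leibniz rule, the four mixed terms left by the two instances of [k1] recombine into a
   second copy of the [D F] term; every term is then doubled. *)
have DDF A B : g (D (b A (J B))) X = g (b (D A) (J B)) X + g (b A (J (D B))) X.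
  by rewrite -!DE leibniz !DE DJb gDl.
have pX v : g (b X v) X = 0 by case: (bX_perp v).
have pY v : g (b X v) Y = 0 by case: (bX_perp v).
have pU v : g (b X v) U = 0 by case: (bX_perp v).
have qX v : g (b X v) (J X) = 0 by case: (bX_perpJ v).
have qY v : g (b X v) (J Y) = 0 by case: (bX_perpJ v).
have qU v : g (b X v) (J U) = 0 by case: (bX_perpJ v).
have := k1 Y U pY pU qU pX qX; have := k1 U Y pU pY qY pX qX.
rewrite !dtorsion0 !DE !DD !gE !DDF.
rewrite (bC (J (D Y)) U) (bC (J (D U)) Y) (gC Y) !gE.
rewrite !(gC (b X U)) !(gC (b X (J U))) !(gC (D U) (D Y)) !(gC (D (J U))).
rewrite !(gC _ (b X (J X))); lra.
Qed.
End Polarized.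

(** * The ascending central series and the [J]-invariance of the center *)

Fixpoint upper_central (k : nat) (v : V) : Prop :=
  match k with
  | 0 => v = 0
  | k'.+1 => forall w, upper_central k' (b v w)
  end.

Hypothesis nilpotent : exists k, forall v, upper_central k v.

Let upperN k v : upper_central k v -> upper_central k (- v).
Proof.
elim: k v => [|k IH] v /=; first by move=> ->; rewrite oppr0.
by move=> h w; rewrite bNl; apply: IH.
Qed.

Let upperD k u v : upper_central k u -> upper_central k v -> upper_central k (u + v).
Proof.
elim: k u v => [|k IH] u v /=; first by move=> -> ->; rewrite addr0.
by move=> hu hv w; rewrite bDl; apply: IH.
Qed.

Let central v := forall w, b v w = 0.

Let sqr_sum4 (x y z t : V) : g x x + g y y + g z z + g t t = 0 -> [/\ x = 0, y = 0, z = 0 & t = 0].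
Proof.
move=> h; have := g_ge0 x; have := g_ge0 y; have := g_ge0 z; have := g_ge0 t => *.
by split; apply: g_eq0; lra.
Qed.

(** If [Y] lies in a term of the ascending series, [[Y, J Y]] and [[J X, Y]] lie in the previous
    one, where the adjoint map of [J X] vanishes by induction. The identity then reduces to the
    squares of [[J X, J Y]] and [[J X, Y]]. *)
Let central_J X : central X -> central (J X).
Proof.
move=> cX.
have h1 v w : b (b X v) w = 0 by rewrite cX b0l.
have h2 v w : b (J (b X v)) w = 0 by rewrite cX J0 b0l.
have h3 Y v : [/\ g (b X v) X = 0, g (b X v) Y = 0 & g (b X v) Y = 0].
  by rewrite cX !g0l.
have h4 Y v : [/\ g (b X v) (J X) = 0, g (b X v) (J Y) = 0 & g (b X v) (J Y) = 0].
  by rewrite cX !g0l.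
have [k hk] := nilpotent.
suff h m Y : upper_central m Y -> b (J X) Y = 0 by move=> Y; apply: h (hk Y).
elim: m Y => [|m IH] Y; first by move=> ->; rewrite b0r.
move=> /= hY.
have F0 : b (J X) (b Y (J Y)) = 0 by apply: IH.
have D0 : b (J X) (b (J X) Y) = 0 by apply: IH; rewrite bC; apply: upperN.
have := polarized_identity h1 h2 (h3 Y) (h4 Y).
rewrite !cX !bDr F0 D0 !gE => pol.
have [|_ _ _ //] := @sqr_sum4 0 0 (b (J X) (J Y)) (b (J X) Y).
by rewrite !gE; lra.
Qed.

(** * Orthogonal projection onto the center *)

Fixpoint gram_schmidt (s : seq V) (x : V) : V :=
  if s is a :: s' then
    let a' := a - gram_schmidt s' a in
    gram_schmidt s' x + (g x a' / g a' a') *: a'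
  else 0.

(** The family [s] may be dependent: a vector in the span of the following ones has [a' = 0], and
    its term in [gram_schmidt] disappears. *)
Let gram_schmidtP s x : gram_schmidt s x \in << s >>%VS /\
  forall w, w \in << s >>%VS -> g (x - gram_schmidt s x) w = 0.
Proof.
elim: s x => [|a s IH] x.
  by split=> [|w]; rewrite ?mem0v // span_nil memv0 => /eqP ->; rewrite g0r.
have [ina orta] := IH a; have [inx ortx] := IH x.
rewrite /= span_cons; set a' := a - _.
have sub v : v \in << s >>%VS -> v \in (<[a]> + << s >>)%VS.
  by move=> h; rewrite -[v]add0r memv_add ?mem0v.
have a'in : a' \in (<[a]> + << s >>)%VS.
  apply: rpredB; last exact: sub.
  by have := memv_add (memv_line a) (mem0v << s >>%VS); rewrite addr0.
split; first by apply: rpredD; [exact: sub|exact: rpredZ].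
have e : g x a' = g (x - gram_schmidt s x) a'.
  by rewrite gDl gNl (gC (gram_schmidt s x)) orta // oppr0 addr0.
move=> w /memv_addP[_ /vlineP[k ->] [u us ->]].
have -> : k *: a + u = k *: a' + (k *: gram_schmidt s a + u).
  by rewrite addrA -scalerDr subrK.
have us' : k *: gram_schmidt s a + u \in << s >>%VS by rewrite rpredD // rpredZ.
rewrite opprD (addrA x); move: us' ortx e; set y := x - _ => us' ortx e.
move: (_ + u) us' => u' us'; have orta' : g a' u' = 0 := orta _ us'.
move: a' (sub) a'in e orta' => a' _ _ e orta'.
rewrite gDl gNl !gDr !gZl (ortx u') // orta'.
rewrite mulr0 !addr0 !gZr -e.
case: (eqVneq a' 0) => [->|a'0]; first by rewrite !gE !mulr0 subrr.
by rewrite mulrCA -mulrA mulVf ?mulr1 ?subrr // gt_eqF // g_gt0.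
Qed.

Let center_proj : exists p : V -> V, forall x, central (p x) /\
  forall z, central z -> g (x - p x) z = 0.
Proof.
have bL e : linear (fun v => b v e).
  by move=> a u v; rewrite bDl (bC (_ *: _)) bZr (bC u) scalerN.
pose ad e : {linear V -> V} := HB.pack (fun v => b v e) (GRing.isLinear.Build _ _ _ _ _ (bL e)).
(* The center as a subspace: it is enough to commute with a basis. *)
pose U := (\bigcap_(e <- vbasis {:V}) lker (linfun (ad e)))%VS.
have UP z : reflect (central z) (z \in U).
  apply: (iffP idP) => [zU w|cz].
    have := memvf w; rewrite -(span_basis (vbasisP fullv)).
    move: zU; rewrite /U; move: (vbasis _) => s; move: (tval s) => {}s.
    elim: s w => [|e s IH] w.
      by move=> _; rewrite span_nil memv0 => /eqP ->; rewrite b0r.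
    rewrite big_cons memv_cap => /andP[ze zs].
    rewrite span_cons => /memv_addP[_ /vlineP[k ->] [u us ->]].
    rewrite bDr bZr (IH u) // addr0.
    by move: ze; rewrite memv_ker lfunE /= => /eqP ->; rewrite scaler0.
  rewrite /U; elim/big_ind: _ => [|A B|e _]; rewrite ?memvf //.
    by rewrite memv_cap => -> ->.
  by rewrite memv_ker lfunE /= cz.
exists (gram_schmidt (vbasis U)) => x.
have [h1 h2] := gram_schmidtP (vbasis U) x.
rewrite (span_basis (vbasisP U)) in h1 h2.
by split=> [|z /UP]; [exact/UP|exact: h2].
Qed.

(** * Brackets lying in the second center *)

Section SecondCenter.
Variables (A B Z X : V).
Hypothesis central_Z : central Z.
Hypothesis XE : X = b A B - Z.
Hypothesis X_perp : forall z, central z -> g X z = 0.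
Hypothesis ABu_central : forall v, central (b (b A B) v).

Let D v := b (J X) v.
Let E := b X (J X).
Let F u v := b u (J v) + b v (J u).

Let bX_central v : central (b X v).
Proof. by move=> w; rewrite XE bDl bNl central_Z oppr0 addr0 ABu_central. Qed.
Let JX_perp z : central z -> g (J X) z = 0.
Proof. by move=> cz; rewrite gJl X_perp ?oppr0 //; exact: central_J. Qed.
Let DD u v : D (u + v) = D u + D v. Proof. exact: bDr. Qed.
Let DN v : D (- v) = - D v. Proof. exact: bNr. Qed.
Let D0 : D 0 = 0. Proof. exact: b0r. Qed.
Let D_central z : central z -> D z = 0.
Proof. by move=> cz; rewrite /D bC cz oppr0. Qed.
Let DJ v : D (J v) = J (D v) + (b X v + J (b X (J v))).
Proof. by rewrite /D integ JD addrCA. Qed.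
Let Db u v : D (b u v) = b (D u) v + b u (D v). Proof. exact: leibniz. Qed.
Let bDJ u v : b u (D (J v)) = b u (J (D v)).
Proof.
rewrite DJ !bDr (bC u (b X v)) (bC u (J (b X _))) bX_central.
by rewrite (central_J (bX_central _)) !oppr0 !addr0.
Qed.
(** [D] is a derivation commuting with [J] up to central terms, and these disappear inside the
    brackets that make up [F]. *)
Let DF u v : D (F u v) = F (D u) v + F u (D v).
Proof. by rewrite /F DD !Db !bDJ; apply: gext => x; rewrite !gE; ring. Qed.

(** The adjoint map of [X] is a derivation with central values, so it kills brackets. *)
Let bXb u v : b X (b u v) = 0.
Proof. by rewrite leibniz bX_central (bC u) bX_central oppr0 addr0. Qed.
Let bXD v : b X (D v) = 0. Proof. exact: bXb. Qed.
Let bXJD v : b X (J (D v)) = 0. Proof. by rewrite -bDJ bXD. Qed.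

(* For central [z], contracting [dtorsion] with [z] gives, up to sign, the
   exterior derivative of [(u, v) -> g (b (J u) (J v)) z]. *)
Let dtorsion_central z u v w : central z ->
  dtorsion u v w z = g (kappa u v w) z.
Proof.
move=> cz; have cJz := central_J cz.
have c0 p : b p z = 0 by rewrite bC cz oppr0.
have cJ0 p : b p (J z) = 0 by rewrite bC cJz oppr0.
by rewrite dtorsionE /kappa /quad !(c0, cz, cJ0, cJz, J0, b0l, b0r, gE); lra.
Qed.

(** Two of the three terms of [kappa X u v] contain [J [X, _]], which is central; the third is, up
    to sign, [D (J (b u v))]. *)
Let gDJb u v z : central z -> g (D (J (b u v))) z = 0.
Proof.
move=> cz; have := dtorsion0 X u v z; rewrite (dtorsion_central _ _ _ cz) /kappa.
rewrite (central_J (bX_central _)) (bC v X) JN bNl (central_J (bX_central _)).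
by rewrite bC -/(D _) !gE; lra.
Qed.
(** This is the previous orthogonality tested against [J z], which is central too, with [J] moved
    across [D]. *)
Let gDb u v z : central z -> g (D (b u v)) z = - g (b X (J (b u v))) z.
Proof.
move=> cz; have := gDJb u v (central_J cz).
rewrite DJ bXb gDl gJ add0r gJ; lra.
Qed.
(** [D (b u v)] is itself a bracket, so [gDb] applies again, and [X] commutes with [J] of the image
    of [D]. *)
Let gDDb u v z : central z -> g (D (D (b u v))) z = 0.
Proof. by move=> cz; rewrite gDb // bXJD gE oppr0. Qed.

Variable (p : V -> V).
Hypothesis pP : forall x, central (p x) /\ forall z, central z -> g (x - p x) z = 0.
Let perp x := x - p x.

Let N u v := g (b X u) (b X v) + g (b X (J u)) (b X (J v))
  + g (D (J u)) (D (J v)) + g (D u) (D v).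

(** [polarized_identity] is applied to [perp u] and [perp v], for which the orthogonality hypotheses
    hold. The discarded components and their images by [J] are central, so no bracket changes. *)
Let N_identity u v :
  N u v = g E (F u v) - g (D (D u)) (perp v) - g (perp u) (D (D v)) - g (D (F u v)) X.
Proof.
have [cu pu] := pP u; have [cv pv] := pP v.
have c0 q z : central z -> b q z = 0 by move=> cz; rewrite bC cz oppr0.
have cJ := central_J.
have h1 x w : b (b X x) w = 0 by exact: bX_central.
have h2 x w : b (J (b X x)) w = 0 by exact: (central_J (bX_central _)).
have h3 x : [/\ g (b X x) X = 0, g (b X x) (perp u) = 0 & g (b X x) (perp v) = 0].
  by rewrite !(gC (b X x)) X_perp ?pu ?pv //; exact: bX_central.
have h4 x : [/\ g (b X x) (J X) = 0, g (b X x) (J (perp u)) = 0 & g (b X x) (J (perp v)) = 0].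
  rewrite !(gC (b X x)) JX_perp; last exact: bX_central.
  by rewrite !gJl pu ?pv ?oppr0 //; apply: central_J; exact: bX_central.
have := polarized_identity h1 h2 h3 h4.
have e q x : central (p x) -> b q (perp x) = b q x /\ b q (J (perp x)) = b q (J x).
  by move=> c; rewrite /perp JD !bDr JN !bNr (c0 _ _ c) (c0 _ _ (cJ _ c)) oppr0 !addr0.
have eF x y : central (p x) -> b (perp x) (J y) = b x (J y).
  by move=> cx; rewrite bC; have [-> _] := e (J y) x cx; rewrite -bC.
rewrite !(proj1 (e _ _ cu)) !(proj2 (e _ _ cu)) !(proj1 (e _ _ cv)) !(proj2 (e _ _ cv)).
by rewrite !eF.
Qed.

Let N_ge0 u : g (D u) (D u) <= N u u.
Proof.
rewrite /N; have := g_ge0 (b X u); have := g_ge0 (b X (J u)).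
by have := g_ge0 (D (J u)); lra.
Qed.

(** For bilinear [f], the derivative at [t = 0] of [f (exp (t D) u) (exp (t D) v)]; iterating
    [shift] gives the higher derivatives, whence the binomial coefficients below. *)
Let shift (f : V -> V -> R) u v := f (D u) v + f u (D v).

Let iter_shiftE k f u v : iter k shift f u v =
  \sum_(i < k.+1) (f (iter i D u) (iter (k - i) D v)) *+ 'C(k, i).
Proof.
elim: k u v => [|k IH] u v; first by rewrite big_ord1 bin0 mulr1n.
rewrite iterS /shift !IH; pose a j := f (iter j D u) (iter (k.+1 - j) D v).
rewrite (eq_bigr (fun i : 'I_k.+1 => a i.+1 *+ 'C(k, i))); last first.
  by move=> i _; rewrite -iterSr /a subSS.
rewrite [X in _ + X](eq_bigr (fun i : 'I_k.+1 => a i *+ 'C(k, i))); last first.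
  by move=> i _; rewrite -iterSr /a subSn // -ltnS.
rewrite -/(a _) [RHS](eq_bigr (fun i : 'I_k.+2 => a i *+ 'C(k.+1, i))) //.
rewrite [RHS]big_ord_recl [X in _ = _ + X](eq_bigr
    (fun i : 'I_k.+1 => a i.+1 *+ 'C(k, i.+1) + a i.+1 *+ 'C(k, i))); last first.
  by move=> i _; rewrite lift0 binS mulrnDr.
rewrite big_split /= [X in _ = _ + (X + _)]big_ord_recr /= (bin_small (ltnSn k)) mulr0n addr0.
rewrite [X in _ + X = _]big_ord_recl /= !bin0.
rewrite addrC -!addrA; congr (_ + _).
Qed.

Let iterD_add k u v : iter k D (u + v) = iter k D u + iter k D v.
Proof. by elim: k => //= k ->; rewrite DD. Qed.
Let iterD0 k : iter k D 0 = 0. Proof. by elim: k => //= k ->. Qed.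

Let iter_shiftF (f : V -> R) k u v : (forall x y, f (x + y) = f x + f y) ->
  iter k shift (fun u v => f (F u v)) u v = f (iter k D (F u v)).
Proof.
move=> fD; elim: k u v => [//|k IH] u v.
by rewrite iterS /shift !IH -fD -iterD_add -DF -iterSr.
Qed.

Let E_central : central E. Proof. exact: bX_central. Qed.

Let gDDF j u v z : central z -> g (iter j.+2 D (F u v)) z = 0.
Proof.
move=> cz; case: j => [|j] /=; first by rewrite /F !DD gDl !gDDb // addr0.
exact: (gDDb (J X) (iter j D (F u v)) cz).
Qed.

Let perp0 : perp 0 = 0.
Proof.
have [c0 p0] := pP 0; apply/g_eq0.
by rewrite {2}/perp sub0r gNr (p0 _ c0) oppr0.
Qed.

Let perp_sqr v : 0 <= g (perp v) v.
Proof.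
have [cv pv] := pP v; have -> : g (perp v) v = g (perp v) (perp v); last exact: g_ge0.
by rewrite {3}/perp gDr gNr (pv _ cv) oppr0 addr0.
Qed.

(** The [D ^ 2] terms of [N_identity] are gathered with [N], so that [M u v] depends on [u] and [v]
    only through [F u v], on which [shift] acts as [D]. *)
Let M u v := N u v + g (D (D u)) (perp v) + g (perp u) (D (D v)).

Let MC u v : M u v = M v u.
Proof.
rewrite /M /N (gC (perp u)) (gC (perp v)) (gC (b X u)) (gC (b X (J u))).
by rewrite (gC (D (J u))) (gC (D u)); ring.
Qed.

Let M0 v : M 0 v = 0.
Proof. by rewrite /M /N J0 !b0r !D0 perp0 !g0l !addr0. Qed.

Let NDD v w : D (D v) = 0 -> N (D v) w = 0.
Proof. by move=> h; rewrite /N bXD bXJD DJ h J0 bXD bXJD J0 !addr0 !g0l !addr0. Qed.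

(* Comparing the two sides of [N_identity] under [shift] iterated
   [2 r - 2] times: only non-negative terms survive on the left. *)
Let D_nilpotent r : (forall v, iter r.+3 D v = 0) -> forall v, iter r.+2 D v = 0.
Proof.
move=> Dr v; pose k := (r.+1 + r.+1)%N.
have Dge m w : (r.+3 <= m)%N -> iter m D w = 0.
  by move=> /subnK <-; rewrite iterD Dr iterD0.
have ME i : M (iter i D v) (iter (k - i) D v) *+ 'C(k, i) =
   (g E (F (iter i D v) (iter (k - i) D v))
     - g (D (F (iter i D v) (iter (k - i) D v))) X) *+ 'C(k, i).
  by rewrite /M N_identity; congr (_ *+ _); ring.
(* After [k] shifts the right side involves [D ^ (k + 1)], which is zero as [k + 1 = 2 r + 3], and
   the product of the central [E] with [D ^ k (F v v)], which is zero as [k] is at least 2. *)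
have sum0 : \sum_(i < k.+1) M (iter i D v) (iter (k - i) D v) *+ 'C(k, i) = 0.
  rewrite (eq_bigr _ (fun i _ => ME (i : 'I_k.+1))).
  rewrite -(iter_shiftE k (fun u v => g E (F u v) - g (D (F u v)) X)).
  rewrite (iter_shiftF (f := fun w => g E w - g (D w) X)); last first.
    by move=> x y; rewrite DD !gE; ring.
  rewrite -iterS (Dge k.+1) ?g0l ?subr0; last by rewrite /k; lia.
  by rewrite gC /k addSn addnS gDDF.
(* By symmetry of [M] the upper half of the sum suffices. For [i = r + 1] only [N] on the diagonal
   remains; for [i = r + 2] only the square of the part of [D ^ (r + 2) v] orthogonal to the center;
   beyond that, nothing. *)
have half i : (r.+1 <= i)%N -> (i <= k)%N -> 0 <= M (iter i D v) (iter (k - i) D v).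
  move=> ri ik; case: (ltnP i r.+3) => [ir|ir]; last by rewrite Dge // M0.
  have : i = r.+1 \/ i = r.+2 by lia.
  case=> ->.
    have -> : (k - r.+1 = r.+1)%N by rewrite /k; lia.
    rewrite /M -[D (D (iter r.+1 D v))]/(iter r.+3 D v) Dr g0l g0r !addr0.
    exact: le_trans (g_ge0 _) (N_ge0 _).
  have -> : (k - r.+2 = r)%N by rewrite /k; lia.
  rewrite /M -[D (D (iter r D v))]/(iter r.+2 D v).
  rewrite [iter r.+2 D v]/(D (iter r.+1 D v)) NDD; last exact: Dr.
  rewrite -[D (D (D _))]/(D (iter r.+3 D v)) Dr D0 g0l !add0r; exact: perp_sqr.
have pos (i : 'I_k.+1) : true -> 0 <= M (iter i D v) (iter (k - i) D v) *+ 'C(k, i).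
  move=> _; apply: mulrn_wge0; case: i => i /=; rewrite ltnS => ik.
  case: (leqP r.+1 i) => [ri|ri]; first exact: half.
  by rewrite MC -{2}(subKn ik); apply: half; rewrite ?leq_subr //; lia.
have rk : (r.+1 < k.+1)%N by rewrite /k; lia.
(* The middle term [i = r + 1] must vanish, and it bounds the square of [D ^ (r + 2) v]. *)
have := @psumr_eq0P _ _ _ _ pos sum0 (Ordinal rk) isT.
move=> /= /eqP; rewrite mulrn_eq0 -leqn0 leqNgt bin_gt0 -ltnS rk /=.
have -> : (k - r.+1 = r.+1)%N by rewrite /k; lia.
rewrite /M -[D (D (iter r.+1 D v))]/(iter r.+3 D v) Dr g0l g0r !addr0 => /eqP N0.
by apply: g_eq0; apply/eqP; rewrite eq_le g_ge0 andbT -N0; exact: N_ge0.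
Qed.

(** Nilpotency makes some power of [D] vanish, and [D_nilpotent] lowers the exponent down to 2.
    Below that, [gDDF] would no longer remove the term in [E]. *)
Let D2 v : D (D v) = 0.
Proof.
have [k hk] := nilpotent.
have up m i w : upper_central (m + i) w -> upper_central i (iter m D w).
  elim: m i => [//|m IH] i; rewrite addSnnS => /IH /= h.
  by rewrite /D bC; apply: upperN.
have Dk w : iter k D w = 0 by apply: (up k 0%N); rewrite addn0.
have Dk3 : forall w, iter k.+2 D w = 0 by move=> w /=; rewrite Dk !D0.
elim: k {hk Dk} Dk3 => [h|k IH h]; first exact: h.
by apply: IH; exact: D_nilpotent.
Qed.

Let E0 : E = 0.
Proof.
have FC u v : F u v = F v u by rewrite /F addrC.
(* [D (F u u)] is twice [F u (D u)]. In [N_identity] for [u] and [D u] everything except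
   [g E (F u (D u))] vanishes by [D2]. *)
have h u : g E (D (F u u)) = 0.
  have FDu : D (F u u) = F u (D u) + F u (D u) by rewrite DF (FC (D u)).
  have := D2 (F u u); rewrite FDu DD; have := N_identity u (D u).
  rewrite /N bXD bXJD (DJ (D u)) !bXD bXJD J0 !D2 J0 !addr0 D0.
  move: (F u (D u)) (D (F u (D u))) => f f'; rewrite !gE => h1.
  by move=> /(congr1 (g^~ X)); rewrite !gE; lra.
have hh u v : g E (D (b u (J v))) = - g E (D (b v (J u))).
  have := h (u + v); have := h u; have := h v.
  by rewrite /F JD !bDr !bDl !DD !gDr; lra.
(* With [J u] for [u], the skew-symmetry [hh] compares [[J u, J v]] with [[v, u]]. By integrability
   [[J u, J v]] differs from [[u, v]] by [J] of brackets, and [D] sends these orthogonally to the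
   central [E]. *)
have h3 u v : g E (D (b u v)) = 0.
  have := hh (J u) v; rewrite JK bNr DN gNr opprK.
  rewrite integ DD gDr [X in _ + X](_ : _ = 0); last first.
    by rewrite JD DD gDr !(gC E) !gDJb ?addr0 //; exact: E_central.
  by rewrite (bC v) DN gNr; lra.
(* Here it matters that [X] is a bracket up to a central term: [h3] for [A] and [B] then concerns
   [D X = - E]. *)
apply: g_eq0; have DX : D X = - E by rewrite /D bC.
have := h3 A B; have -> : D (b A B) = D X by rewrite XE DD DN (D_central central_Z) oppr0 addr0.
by rewrite DX gNr => /eqP; rewrite oppr_eq0 => /eqP.
Qed.

(** With [E = 0] and [D ^ 2 = 0], only the [D F] term of [N_identity] is left. It vanishes by
    induction on the ascending series, which gives [D = 0]; then all four squares vanish, in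
    particular that of [[X, v]]. *)
Lemma second_center_central : central (b A B).
Proof.
have D_eq0 v : D v = 0.
  have [k hk] := nilpotent; move: (hk v); elim: k {hk} v => [|k IH] v; first by move=> ->.
  move=> /= hv; have DF0 : D (F v v) = 0 by apply: IH; apply: upperD; exact: hv.
  apply: g_eq0; apply/eqP; rewrite eq_le g_ge0 andbT.
  by have := N_ge0 v; rewrite N_identity E0 D2 DF0 !gE !subr0.
have bX0 v : b X v = 0.
  have := N_identity v v; rewrite E0 !D_eq0 !gE !subr0.
  by case/sqr_sum4.
move=> v; have := bX0 v; rewrite XE bDl bNl central_Z oppr0 addr0.
by [].
Qed.

End SecondCenter.

Theorem bracket_bracket_eq0 u v w : b u (b v w) = 0.
Proof.
have [p pP] := center_proj.
have step x y : (forall z, central (b (b x y) z)) -> central (b x y).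
  move=> h; have [cp op] := pP (b x y).
  exact: (@second_center_central x y (p (b x y)) _ cp erefl op h p pP).
(* The induction is confined to brackets: [[[x, y], z]] is again a bracket, one step lower, hence
   central by induction, and so [[x, y]] lies in the second center. *)
suff h k x y : upper_central k (b x y) -> central (b x y).
  by rewrite bC; have [k hk] := nilpotent; rewrite (h k v w) ?oppr0.
elim: k x y => [|k IH] x y; first by move=> -> z; rewrite b0l.
by move=> hk; apply: step => z; apply: IH; exact: hk.
Qed.

End HermitianLieAlgebra.

(** * Functions of class C^k *)

Section Calculus.
Variable R : realType.
Implicit Types V W : normedModType R.

Lemma near_is_diff V W (f g : V -> W) (df : V -> W) x :
  (\forall y \near x, f y = g y) -> is_diff x f df -> is_diff x g df.
Proof.
move=> fg fx; have gx : f x = g x := nbhs_singleton fg.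
have [dfc dxf] := (diff_locallyP x f).1 ex_diff.
have dg : g \o shift x = cst (g x) + 'd f x +o_ 0 id.
  apply/eqaddoP => _/posnumP[e]; have := dxf => /eqaddoP/(_ e%:num (gt0 _)) h.
  have fg' : \forall y \near (0 : V), f (y + x) = g (y + x).
    by have := fg; rewrite (near_shift 0) subr0.
  near=> y; rewrite -gx.
  have -> : (g \o shift x - (cst (f x) + 'd f x)) y =
            (f \o shift x - (cst (f x) + 'd f x)) y.
    by rewrite !fctE /=; congr (_ - _); apply/esym; near: y.
  by near: y.
have e := diff_unique dfc dg.
apply: DiffDef; last by rewrite e; exact: diff_val.
by apply/diff_locallyP; rewrite e.
Unshelve. all: by end_near. Qed.

Lemma near_diff V W (f g : V -> W) x : (\forall y \near x, f y = g y) ->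
  differentiable f x -> 'd g x = 'd f x :> (V -> W).
Proof.
by move=> fg /differentiableP fd; have [] := near_is_diff fg fd.
Qed.

Lemma near_differentiable V W (f g : V -> W) x : (\forall y \near x, f y = g y) ->
  differentiable f x -> differentiable g x.
Proof.
by move=> fg /differentiableP fd; have [] := near_is_diff fg fd.
Qed.

Lemma is_diff_scale V W (k dk : V -> R^o) (f df : V -> W) x :
  is_diff x k dk -> is_diff x f df ->
  is_diff x (fun y => k y *: f y) (fun v => k x *: df v + dk v *: f x).
Proof.
move=> kx fx.
have lin : bilinear_for *:%R *:%R (fun (a : R^o) (w : W) => a *: w).
  by split=> [w|a] c y z /=; rewrite ?scalerDl ?scalerDr ?scalerA // mulrC.
pose BM := bilinear_isBilinear.Build R R^o W W _ _ _ lin.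
pose B : {bilinear R^o -> W -> W} := HB.pack (fun (a : R^o) (w : W) => a *: w) BM.
have Bc : continuous (fun p : R^o * W => B p.1 p.2) by exact: scale_continuous.
have pair := is_diff_pair kx fx.
have Bd : is_diff (k x, f x) (fun p : R^o * W => B p.1 p.2)
    (fun q => k x *: q.2 + q.1 *: f x).
  by apply: DiffDef; [exact: differentiable_bilin|rewrite diff_bilin].
exact: (is_diff_comp pair Bd).
Qed.

Lemma is_diff_sum V W (I : finType) (f df : I -> V -> W) x :
  (forall i, is_diff x (f i) (df i)) ->
  is_diff x (fun y => \sum_i f i y) (fun v => \sum_i df i v).
Proof.
move=> h; elim: (index_enum I) => [|i s IH].
  under eq_fun do rewrite big_nil; under [X in is_diff _ _ X]eq_fun do rewrite big_nil.
  exact: is_diff_cst.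
under eq_fun do rewrite big_cons; under [X in is_diff _ _ X]eq_fun do rewrite big_cons.
exact: is_diffD.
Qed.

Lemma open_near V (U : set V) (P : V -> Prop) x :
  open U -> U x -> (forall y, U y -> P y) -> \forall y \near x, P y.
Proof. by move=> oU Ux h; apply: filterS h _; exact: open_nbhs_nbhs. Qed.

Section Ck.
Variables (V : normedModType R) (U : set V).
Hypothesis oU : open U.

Lemma Ck_ext W k (f g : V -> W) :
  (forall x, U x -> f x = g x) -> Ck k U f -> Ck k U g.
Proof.
elim: k f g => [|k IH] f g fg /=.
  move=> fc x Ux; rewrite /prop_for /continuous_at -(fg _ Ux).
  by apply: cvg_trans (fc x Ux); apply: near_eq_cvg; exact: open_near Ux fg.
move=> [fd fc]; split=> [x Ux|v].
  by apply: near_differentiable (fd x Ux); exact: open_near Ux fg.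
apply: IH (fc v) => x Ux; rewrite (near_diff (open_near oU Ux fg)) //; exact: fd.
Qed.

Lemma Ck_sub W k (U' : set V) (f : V -> W) :
  U' `<=` U -> Ck k U f -> Ck k U' f.
Proof.
move=> sub; elim: k f => [|k IH] f /=; first by move=> h x /sub; exact: h.
by move=> [h1 h2]; split=> [x /sub|v]; [exact: h1|exact: IH].
Qed.

Lemma CkS W k (f : V -> W) : Ck k.+1 U f -> Ck k U f.
Proof.
elim: k f => [|k IH] f [fd fc].
  by move=> x Ux; apply: differentiable_continuous; exact: fd.
by split=> [//|v]; apply: IH; exact: fc.
Qed.

Lemma Ck_cst W k (a : W) : Ck k U (fun=> a).
Proof.
elim: k a => [|k IH] a /=; first by move=> x _; exact: cst_continuous.
split=> [x _|v]; first exact: differentiable_cst.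
by apply: Ck_ext (IH 0) => x _; rewrite diff_cst.
Qed.

Lemma CkD W k (f g : V -> W) : Ck k U f -> Ck k U g -> Ck k U (fun x => f x + g x).
Proof.
elim: k f g => [|k IH] f g /=.
  by move=> fc gc x Ux; apply: continuousD; [exact: fc|exact: gc].
move=> [fd fc] [gd gc]; split=> [x Ux|v].
  by apply: differentiableD; [exact: fd|exact: gd].
apply: Ck_ext (IH _ _ (fc v) (gc v)) => x Ux.
by rewrite diffD //; [exact: fd|exact: gd].
Qed.

Lemma Ck_scale W k (c : V -> R^o) (f : V -> W) :
  Ck k U c -> Ck k U f -> Ck k U (fun x => c x *: f x).
Proof.
elim: k c f => [|k IH] c f.
  by move=> cc fc x Ux; apply: continuousZ; [exact: cc|exact: fc].
move=> /[dup] /CkS c0 [cd cc] /[dup] /CkS f0 [fd fc].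
have h x : U x -> is_diff x (fun x => c x *: f x)
    (fun v => c x *: 'd f x v + 'd c x v *: f x).
  by move=> Ux; apply: is_diff_scale; apply: differentiableP; [exact: cd|exact: fd].
split=> [x Ux|v]; first by have [] := h x Ux.
apply: (@Ck_ext _ _ (fun x => c x *: 'd f x v + 'd c x v *: f x)).
  by move=> x Ux; have [_ ->] := h x Ux.
by apply: CkD; [exact: IH c0 (fc v)|exact: IH (cc v) f0].
Qed.

Lemma Ck_sum W k (I : finType) (f : I -> V -> W) :
  (forall i, Ck k U (f i)) -> Ck k U (fun x => \sum_i f i x).
Proof.
move=> h; elim: (index_enum I) => [|i s IH].
  by under eq_fun do rewrite big_nil; exact: Ck_cst.
by under eq_fun do rewrite big_cons; exact: CkD (h i) IH.
Qed.

Lemma Ck_linear W W' k (L : {linear W -> W'}) (f : V -> W) :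
  continuous L -> Ck k U f -> Ck k U (fun x => L (f x)).
Proof.
move=> Lc; elim: k f => [|k IH] f.
  by move=> fc x Ux; apply: continuous_comp; [exact: fc|exact: Lc].
move=> [fd fc]; split=> [x Ux|v].
  by apply: differentiable_comp (linear_differentiable _ Lc); exact: fd.
apply: Ck_ext (IH _ (fc v)) => x Ux.
rewrite [in RHS](_ : (fun x => L (f x)) = L \o f) //.
by rewrite (diff_comp (fd x Ux) (linear_differentiable (f x) Lc)) /= diff_lin.
Qed.

(** [Ck] differentiates along fixed vectors, whereas the chain rule evaluates the differential of
    [g] on a moving one. Expanding the inner map on fixed vectors [e i] gives derivatives of the
    same shape, and the induction closes. *)
Lemma Ck_comp W W' (I : finType) (e : I -> W) (c : I -> V -> R^o) (U' : set W) k
    (g : W -> W') :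
  (forall i, Ck k U (c i)) -> (forall x, U x -> U' (\sum_i c i x *: e i)) ->
  Ck k U' g -> Ck k U (fun x => g (\sum_i c i x *: e i)).
Proof.
move=> + cU; elim: k g => [|k IH] g cC.
  move=> gC x Ux; apply: continuous_comp; last by apply: gC; exact: cU.
  have := @Ck_sum _ 0%N _ (fun i x => c i x *: e i) _ x Ux; apply => i.
  by apply: Ck_scale; [exact: cC|exact: Ck_cst].
move=> [gd gC]; pose f x := \sum_i c i x *: e i.
have fd x : U x -> is_diff x f (fun v => \sum_i 'd (c i) x v *: e i).
  move=> Ux; apply: is_diff_sum => i; have [ci _] := cC i.
  have := is_diff_scale (differentiableP (ci x Ux)) (is_diff_cst (e i) x).
  by move/is_diff_eq; apply; apply/funext => v; rewrite scaler0 add0r.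
have gf x : U x -> is_diff x (g \o f) ('d g (f x) \o (fun v => \sum_i 'd (c i) x v *: e i)).
  move=> Ux; have := fd x Ux => fx; apply: is_diff_comp.
  by apply: differentiableP; apply: gd; exact: cU.
split=> [x Ux|v]; first by have [] := gf x Ux.
apply: (@Ck_ext _ _ (fun x => \sum_i 'd (c i) x v *: 'd g (f x) (e i))).
  move=> x Ux; have [_ ->] := gf x Ux; rewrite /= linear_sum /=.
  by apply: eq_bigr => i _; rewrite linearZ.
apply: Ck_sum => i; apply: Ck_scale; first by have [_] := cC i; apply.
by apply: (IH (fun z => 'd g z (e i))); [move=> j; exact: CkS|exact: gC].
Qed.

End Ck.

Lemma delta_mx_sum n (v : 'rV[R]_n) : v = \sum_i v ord0 i *: delta_mx ord0 i.
Proof. exact: row_sum_delta. Qed.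

Lemma coord_linear n (i : 'I_n) :
  exists2 L : {linear 'rV[R]_n -> R^o}, continuous L & forall v, L v = v ord0 i.
Proof.
have lin : linear (fun v : 'rV[R]_n => v ord0 i : R^o) by move=> a u v; rewrite !mxE.
pose LM := GRing.isLinear.Build _ _ _ _ _ lin.
pose L : {linear 'rV[R]_n -> R^o} := HB.pack (fun v : 'rV[R]_n => v ord0 i : R^o) LM.
by exists L => //; exact: coord_continuous.
Qed.

Lemma diff_coord n V (f : V -> 'rV[R]_n) i x v : differentiable f x ->
  'd (fun y => f y ord0 i : R^o) x v = 'd f x v ord0 i.
Proof.
move=> fd; have [L Lc LE] := coord_linear i.
rewrite (_ : (fun y => _) = L \o f); last by apply/funext => y /=; rewrite LE.
by rewrite (diff_comp fd (linear_differentiable (f x) Lc)) /= diff_lin // LE.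
Qed.

Lemma differentiable_rV_coord n V (f : V -> 'rV[R]_n) i x : differentiable f x ->
  differentiable (fun y => f y ord0 i : R^o) x.
Proof.
move=> fd; have [L Lc LE] := coord_linear i.
rewrite (_ : (fun y => _) = L \o f); last by apply/funext => y /=; rewrite LE.
exact: differentiable_comp fd (linear_differentiable (f x) Lc).
Qed.

Lemma Ck_coord n V (U : set V) k (f : V -> 'rV[R]_n) i : open U ->
  Ck k U f -> Ck k U (fun y => f y ord0 i : R^o).
Proof.
move=> oU; have [L Lc LE] := coord_linear i => /(Ck_linear oU Lc).
by apply: Ck_ext => // x _; rewrite LE.
Qed.

Lemma Ck_comp_rV n V W (U : set V) (U' : set 'rV[R]_n) k (f : V -> 'rV[R]_n)
    (g : 'rV[R]_n -> W) : open U -> Ck k U f -> (forall x, U x -> U' (f x)) ->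
  Ck k U' g -> Ck k U (fun x => g (f x)).
Proof.
move=> oU fC fU gC; have e x := esym (delta_mx_sum (f x)).
apply: (@Ck_ext _ _ oU _ _ (fun x => g (\sum_i f x ord0 i *: delta_mx ord0 i))).
  by move=> x _; rewrite e.
apply: (@Ck_comp _ _ oU _ _ _ _ _ U') => // [i|x Ux]; first exact: Ck_coord.
by rewrite e; exact: fU.
Qed.

Lemma Ck_comp_rV2 n V W (U : set V) (U' : set ('rV[R]_n * 'rV[R]_n)) k
    (f1 f2 : V -> 'rV[R]_n) (g : 'rV[R]_n * 'rV[R]_n -> W) : open U ->
  Ck k U f1 -> Ck k U f2 -> (forall x, U x -> U' (f1 x, f2 x)) ->
  Ck k U' g -> Ck k U (fun x => g (f1 x, f2 x)).
Proof.
move=> oU f1C f2C fU gC.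
pose e (i : 'I_n + 'I_n) : 'rV[R]_n * 'rV[R]_n :=
  match i with inl j => (delta_mx ord0 j, 0) | inr j => (0, delta_mx ord0 j) end.
pose c (i : 'I_n + 'I_n) x : R^o :=
  match i with inl j => f1 x ord0 j | inr j => f2 x ord0 j end.
have E x : \sum_i c i x *: e i = (f1 x, f2 x).
  rewrite big_sumType /= [LHS]surjective_pairing; congr pair => /=.
    rewrite !raddf_sum /= [X in _ + X]big1 ?addr0.
      by rewrite [RHS]delta_mx_sum.
    by move=> j _; rewrite scaler0.
  rewrite !raddf_sum /= [X in X + _]big1 ?add0r.
    by rewrite [RHS]delta_mx_sum.
  by move=> j _; rewrite scaler0.
apply: (@Ck_ext _ _ oU _ _ (fun x => g (\sum_i c i x *: e i))).
  by move=> x _; rewrite E.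
apply: (@Ck_comp _ _ oU _ _ _ _ _ U') => // [[] i /=|x Ux].
- exact: Ck_coord.
- exact: Ck_coord.
- by rewrite E; exact: fU.
Qed.

(** Differentiability of [B] for each fixed argument is enough, because [A y] expands on the finite
    standard basis. *)
Lemma is_diff_bilinear n V W (B : V -> 'rV[R]_n -> W) (A : V -> 'rV[R]_n) x :
  (\forall y \near x, linear (B y)) ->
  (forall a, differentiable (fun y => B y a) x) -> differentiable A x ->
  is_diff x (fun y => B y (A y))
    (fun w => 'd (fun y => B y (A x)) x w + B x ('d A x w)).
Proof.
move=> Bl Bd Ad.
have BE y (a : 'rV[R]_n) : linear (B y) ->
    B y a = \sum_i a ord0 i *: B y (delta_mx ord0 i).
  move=> Byl; pose BM := GRing.isLinear.Build _ _ _ _ _ Byl.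
  pose BL : {linear _ -> _} := HB.pack (B y) BM.
  rewrite {1}(delta_mx_sum a) -[B y]/(BL : _ -> _) linear_sum.
  by apply: eq_bigr => i _; rewrite linearZ.
have h : is_diff x (fun y => \sum_i A y ord0 i *: B y (delta_mx ord0 i))
   (fun w => \sum_i (A x ord0 i *: 'd (fun y => B y (delta_mx ord0 i)) x w
                      + 'd A x w ord0 i *: B x (delta_mx ord0 i))).
  apply: is_diff_sum => i.
  have := is_diff_scale (differentiableP (differentiable_rV_coord i Ad))
            (differentiableP (Bd (delta_mx ord0 i))).
  by move/is_diff_eq; apply; apply/funext => w; rewrite diff_coord.
have hx : is_diff x (fun y => \sum_i A x ord0 i *: B y (delta_mx ord0 i))
   (fun w => \sum_i A x ord0 i *: 'd (fun y => B y (delta_mx ord0 i)) x w).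
  apply: is_diff_sum => i; exact: is_diffZ (differentiableP (Bd _)).
have [_ ex] : is_diff x (fun y => B y (A x))
   (fun w => \sum_i A x ord0 i *: 'd (fun y => B y (delta_mx ord0 i)) x w).
  by apply: near_is_diff hx; apply: filterS Bl => y Byl; rewrite -BE.
have : is_diff x (fun y => B y (A y))
    (fun w => \sum_i (A x ord0 i *: 'd (fun y => B y (delta_mx ord0 i)) x w
                      + 'd A x w ord0 i *: B x (delta_mx ord0 i))).
  by apply: near_is_diff h; apply: filterS Bl => y Byl; rewrite -BE.
move/is_diff_eq; apply; apply/funext => w; rewrite big_split /= ex; congr (_ + _).
by rewrite [RHS]BE //; exact: nbhs_singleton Bl.
Qed.

(** * Mean value theorem and symmetry of second derivatives *)

Lemma is_derive_line V (f : V -> R^o) x u t : differentiable f (x + t *: u) ->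
  is_derive t 1 (fun s : R => f (x + s *: u)) ('d f (x + t *: u) u).
Proof.
move=> fd; have hl : is_diff t (fun s : R^o => x + s *: u) (fun s => s *: u).
  have := is_diffD (is_diff_cst x t) (is_diff_scalel t u).
  by move/is_diff_eq; apply; apply/funext => s /=; rewrite add0r.
have [hd he] := is_diff_comp hl (differentiableP fd).
apply: DeriveDef; first exact: diff_derivable hd.
by rewrite deriveE // he /= scale1r.
Qed.

Lemma MVT_line V (f : V -> R^o) x u (h : R) : 0 <= h ->
  (forall t, 0 <= t <= h -> differentiable f (x + t *: u)) ->
  exists2 t, 0 <= t <= h & f (x + h *: u) - f x = 'd f (x + t *: u) u * h.
Proof.
move=> h0 fd.
have dphi t : 0 <= t <= h -> is_derive t 1 (fun s : R => f (x + s *: u)) ('d f (x + t *: u) u).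
  by move=> /fd; exact: is_derive_line.
have [||t] := @MVT_segment R (fun s => f (x + s *: u)) (fun t => 'd f (x + t *: u) u) 0 h h0.
- by move=> t; rewrite in_itv /= => /andP[t0 th]; apply: dphi; rewrite !ltW.
- apply: derivable_within_continuous => t; rewrite in_itv /= => ht.
  by have [] := dphi t ht.
rewrite in_itv /= => ht; rewrite scale0r addr0 subr0 => e.
by exists t.
Qed.

(** The mean value theorem is used twice: along [u] for the increment of [f] by [h *: v], then along
    [v] for the derivative of [f] in the direction [u]. *)
Lemma second_difference V (U : set V) (f : V -> R^o) x u v (h : R) : 0 < h ->
  Ck 2 U f ->
  (forall s t, 0 <= s <= h -> 0 <= t <= h -> U (x + s *: u + t *: v)) ->
  exists s t, [/\ 0 <= s <= h, 0 <= t <= h &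
   f (x + h *: u + h *: v) - f (x + h *: u) - (f (x + h *: v) - f x) =
   'd (fun y => 'd f y u : R^o) (x + s *: u + t *: v) v * h * h].
Proof.
move=> h0 [fd fc] inU; have hh : 0 <= h <= h by rewrite lexx ltW.
have h00 : 0 <= (0:R) <= h by rewrite lexx ltW.
pose G y : R^o := f (y + h *: v) - f y.
have dG s : 0 <= s <= h -> is_diff (x + s *: u) G
    (fun w => 'd f (x + s *: u + h *: v) w - 'd f (x + s *: u) w).
  move=> hs; apply: is_diffB; last first.
    by apply: differentiableP; apply: fd; have := inU s 0 hs h00; rewrite scale0r addr0.
  have ht : is_diff (x + s *: u) (fun y => y + h *: v) id.
    have := is_diffD (is_diff_id (x + s *: u)) (is_diff_cst (h *: v) (x + s *: u)).
    by move/is_diff_eq; apply; apply/funext => y /=; rewrite !fctE addr0.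
  exact: (is_diff_comp ht (differentiableP (fd _ (inU s h hs hh)))).
have [s hs es] : exists2 s, 0 <= s <= h & G (x + h *: u) - G x = 'd G (x + s *: u) u * h.
  by apply: MVT_line; [exact: ltW|move=> s /dG []].
have [_ dGs] := dG s hs.
have [t ht et] : exists2 t, 0 <= t <= h &
   'd f (x + s *: u + h *: v) u - 'd f (x + s *: u) u
    = 'd (fun y => 'd f y u : R^o) (x + s *: u + t *: v) v * h.
  apply: (@MVT_line V (fun y => 'd f y u)); first exact: ltW.
  by move=> t ht; apply: (fc u).1; exact: inU.
exists s, t; split => //; rewrite -et -[LHS]/(G (x + h *: u) - G x) es dGs.
by [].
Qed.

Lemma Schwarz_scalar V (U : set V) (f : V -> R^o) x u v : open U -> U x ->
  Ck 2 U f -> 'd (fun y => 'd f y u : R^o) x v = 'd (fun y => 'd f y v : R^o) x u.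
Proof.
move=> oU Ux fC; apply/eqP; rewrite -subr_eq0; apply/negPn/negP => ne.
set a := 'd _ _ _ in ne *; set b := 'd _ _ _ in ne *.
pose e := `|a - b|; have e0 : 0 < e by rewrite normr_gt0.
have near_of w1 w2 : \forall y \near x,
    U y /\ `|'d (fun y => 'd f y w1 : R^o) x w2 - 'd (fun y => 'd f y w1 : R^o) y w2| < e / 2.
  have [_ /(_ w1)[_ /(_ w2 x Ux) cont]] := fC.
  near=> y; split; first by near: y; exact: open_nbhs_nbhs.
  by near: y; move/cvgrPdist_lt : cont; apply; rewrite divr_gt0.
have [r r0 rP] : exists2 r, 0 < r & forall y, `|x - y| < r ->
   [/\ U y, `|a - 'd (fun y => 'd f y u : R^o) y v| < e / 2
     & `|b - 'd (fun y => 'd f y v : R^o) y u| < e / 2].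
  have nb : nbhs x ((fun y => U y /\ `|a - 'd (fun y => 'd f y u : R^o) y v| < e / 2) `&`
     (fun y => U y /\ `|b - 'd (fun y => 'd f y v : R^o) y u| < e / 2)).
    exact: filterI (near_of u v) (near_of v u).
  have [r /= r0 h] := (nbhs_ballP x _).1 nb.
  by exists r => // y xy; have := h y; rewrite -ball_normE /ball_ /= => /(_ xy) [[? ?] [_ ?]].
(* The parallelogram of sides [h *: u] and [h *: v] stays in the ball of radius [r]; the [+ 1] keeps
   the denominator positive when [u = v = 0]. *)
pose h := r / (2 * (`|u| + `|v| + 1)).
have c0 : 0 < `|u| + `|v| + 1 by rewrite ltr_pwDr // addr_ge0.
have h0 : 0 < h by rewrite divr_gt0 // mulr_gt0.
have small s t : 0 <= s <= h -> 0 <= t <= h -> `|x - (x + s *: u + t *: v)| < r.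
  move=> /andP[s0 sh] /andP[t0 th]; rewrite -addrA opprD addrA subrr sub0r normrN.
  apply: le_lt_trans (ler_normD _ _) _; rewrite !normrZ !ger0_norm //.
  have : s * `|u| + t * `|v| <= h * (`|u| + `|v| + 1).
    rewrite mulrDr mulr1 mulrDr; apply: ler_wpDr; first exact: ltW.
    by rewrite lerD // ler_wpM2r.
  move=> /le_lt_trans; apply.
  rewrite /h invfM mulrA -mulrA mulVf ?gt_eqF // mulr1.
  by rewrite ltr_pdivrMr // ltr_pMr // ltr1n.
have inU s t : 0 <= s <= h -> 0 <= t <= h -> U (x + s *: u + t *: v).
  by move=> hs ht; case: (rP _ (small s t hs ht)).
have inU' s t : 0 <= s <= h -> 0 <= t <= h -> U (x + s *: v + t *: u).
  by move=> hs ht; rewrite addrAC; exact: inU.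
have [s [t [hs ht E1]]] := second_difference h0 fC inU.
have [s' [t' [hs' ht' E]]] := second_difference h0 fC inU'.
(* The second difference is symmetric in [u] and [v], so the two mixed derivatives agree at two
   nearby points; each is within [e / 2] of its value at [x], which contradicts the choice of
   [e]. *)
have E' : f (x + h *: v + h *: u) - f (x + h *: v) - (f (x + h *: u) - f x) =
   f (x + h *: u + h *: v) - f (x + h *: u) - (f (x + h *: v) - f x).
  by rewrite (addrAC x); ring.
move: E1; rewrite -E' E => /mulIf -/(_ (lt0r_neq0 h0)) /mulIf -/(_ (lt0r_neq0 h0)).
have [_ h1 _] := rP _ (small s t hs ht).
have [_ _ h2] := rP _ (small t' s' ht' hs').
rewrite (addrAC x (s' *: v)) => e12; move: h2; rewrite e12 => h2.
have : e < e.
  rewrite {1}/e -(subrK ('d (fun y => 'd f y u : R^o) (x + s *: u + t *: v) v) a) -addrA.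
  apply: le_lt_trans (ler_normD _ _) _; rewrite [ltRHS]splitr; apply: ltrD => //.
  by rewrite distrC.
by rewrite ltxx.
Unshelve. all: by end_near. Qed.

Lemma Schwarz n V (U : set V) (f : V -> 'rV[R]_n) x u v : open U -> U x ->
  Ck 2 U f -> 'd (fun y => 'd f y u) x v = 'd (fun y => 'd f y v) x u.
Proof.
move=> oU Ux fC; apply/rowP => i; have [fd fc] := fC.
have h w : U `<=` (fun y => 'd (fun y => f y ord0 i : R^o) y w = 'd f y w ord0 i).
  by move=> y Uy; rewrite diff_coord //; exact: fd.
have dd w w' : 'd (fun y => 'd f y w) x w' ord0 i =
    'd (fun y => 'd (fun y => f y ord0 i : R^o) y w : R^o) x w'.
  have dw : differentiable (fun y => 'd f y w) x by apply: (fc w).1.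
  rewrite -diff_coord //; apply/esym.
  have nd := open_near oU Ux (fun y Uy => esym (h w y Uy)).
  by rewrite (near_diff nd (differentiable_rV_coord i dw)).
by rewrite !dd; apply: Schwarz_scalar (Ck_coord i oU fC).
Qed.

Lemma diff0_ball_cst n V (f : V -> 'rV[R]_n) x (r : R) :
  (forall y, ball x r y -> differentiable f y) ->
  (forall y v, ball x r y -> 'd f y v = 0) ->
  forall y, ball x r y -> f y = f x.
Proof.
move=> fd f0 y xy; apply/rowP => i.
have seg t : 0 <= t <= 1 -> ball x r (x + t *: (y - x)).
  move=> /andP[t0 t1]; rewrite -ball_normE /ball_ /= opprD addrA subrr sub0r normrN.
  rewrite normrZ ger0_norm // distrC; apply: le_lt_trans (_ : `|x - y| < r).
    by rewrite ler_piMl.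
  by have := xy; rewrite -ball_normE.
have [t ht] : exists2 t, 0 <= t <= 1 & f (x + (1:R) *: (y - x)) ord0 i - f x ord0 i
    = 'd (fun y => f y ord0 i : R^o) (x + t *: (y - x)) (y - x) * 1.
  apply: (@MVT_line V (fun y => f y ord0 i)) => // t ht.
  by apply: differentiable_rV_coord; apply: fd; exact: seg.
rewrite diff_coord; last by apply: fd; exact: seg.
rewrite f0 ?mxE ?mul0r; last exact: seg.
by rewrite scale1r (addrC x) subrK => /eqP; rewrite subr_eq0 => /eqP.
Qed.

End Calculus.

(** * Left-invariant vector fields *)

(** Products of maps into the group factor through charts that depend on the point, so their
    smoothness is only proved locally. *)
Lemma Ck_local (R : realType) (V W : normedModType R) k (U : set V) (f : V -> W) :
  (forall x, U x -> exists2 U' : set V, U' x & Ck k U' f) -> Ck k U f.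
Proof.
elim: k f => [|k IH] f h.
  by move=> x Ux; have [U' U'x] := h x Ux; apply.
split=> [x Ux|v]; first by have [U' U'x [fd _]] := h x Ux; exact: fd.
by apply: IH => x Ux; have [U' U'x [_ fc]] := h x Ux; exists U'; [|exact: fc].
Qed.

Lemma Ck_id (R : realType) (V : normedModType R) k (U : set V) :
  open U -> Ck k U (fun x : V => x).
Proof.
move=> oU; case: k => [|k]; first by move=> x _; exact: cvg_id.
have d x : is_diff x (fun x : V => x) id by exact: is_diff_id.
split=> [x _|v]; first by have [] := d x.
by apply: (Ck_ext oU) (Ck_cst oU k v) => x _; have [_ ->] := d x.
Qed.

Section LieGroup.
Variables (R : realType) (n : nat) (N : lieGroup R n).
Local Notation V := 'rV[R]_n.
Local Notation I := (Defs.index (lie_atlas N)).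
Implicit Types (i j k : I) (F G : N -> N) (p q : N).

Definition smooth_map F :=
  continuous F /\ forall i j, smooth (rep_on F i j) (rep F i j).

Lemma open_rep_on F i j : continuous F -> open (rep_on F i j).
Proof.
move=> Fc; rewrite openE => x [ix jx]; rewrite /interior.
have cx : {for x, continuous (chart_inv i)} := chart_inv_continuous ix.
apply: filterI; first by apply: open_nbhs_nbhs; split; [exact: img_open|].
have : {for x, continuous (F \o chart_inv i)} by apply: continuous_comp => //; exact: Fc.
by apply; apply: open_nbhs_nbhs; split; [exact: dom_open|].
Qed.

Lemma rep_cst p i j : smooth (rep_on (fun=> p) i j) (rep (fun=> p) i j).
Proof. by move=> k; apply: Ck_cst; apply: open_rep_on => ?; exact: cvg_cst. Qed.

Lemma smooth_map_cst p : smooth_map (fun=> p).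
Proof. by split=> [?|]; [exact: cvg_cst|exact: rep_cst]. Qed.

Lemma smooth_map_id : smooth_map id.
Proof. by split=> [?|i j]; [exact: cvg_id|exact: transition_smooth]. Qed.

Lemma smooth_map_mul F G : smooth_map F -> smooth_map G ->
  smooth_map (fun p => F p * G p)%g.
Proof.
move=> [Fc Fs] [Gc Gs]; have FGc : continuous (fun p => F p * G p)%g.
  move=> p; apply: (@continuous_comp _ _ _ (fun p => (F p, G p)) (fun xy => xy.1 * xy.2)%g).
    by apply: cvg_pair; [exact: Fc|exact: Gc].
  exact: mulg_continuous.
split=> // i k d; apply: Ck_local => x [ix kx].
have [a ax] := chart_cover (lie_atlas N) (F (chart_inv i x)).
have [b bx] := chart_cover (lie_atlas N) (G (chart_inv i x)).
pose U' := rep_on F i a `&` rep_on G i b `&` rep_on (fun p => F p * G p)%g i k.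
have oU' : open U' by apply: openI; [apply: openI|]; exact: open_rep_on.
exists U' => //; apply: (@Ck_ext _ _ _ oU' _ _
   (fun y => chart k (chart_inv a (rep F i a y, rep G i b y).1
                      * chart_inv b (rep F i a y, rep G i b y).2)%g)).
  by move=> y [[[iy ay] [_ by_]] [_ ky]]; rewrite /= /rep !chartK.
apply: (Ck_comp_rV2 (g := fun xy => chart k (chart_inv a xy.1 * chart_inv b xy.2)%g) oU'
   _ _ _ (mul_smooth a b k d)).
- by apply: Ck_sub (Fs i a d) => y [[]].
- by apply: Ck_sub (Gs i b d) => y [[]].
- move=> y [[[iy ay] [_ by_]] [_ ky]]; split=> /=; [exact: chart_img..|].
  by rewrite /rep !chartK.
Qed.

Lemma smooth_map_inv F : smooth_map F -> smooth_map (fun p => (F p)^-1)%g.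
Proof.
move=> [Fc Fs]; have FVc : continuous (fun p => (F p)^-1)%g.
  move=> p; apply: (@continuous_comp _ _ _ F (fun x => x^-1)%g); first exact: Fc.
  exact: invg_continuous.
split=> // i k d; apply: Ck_local => x [ix kx].
have [a ax] := chart_cover (lie_atlas N) (F (chart_inv i x)).
pose U' := rep_on F i a `&` rep_on (fun p => (F p)^-1)%g i k.
have oU' : open U' by apply: openI; exact: open_rep_on.
exists U' => //; apply: (@Ck_ext _ _ _ oU' _ _
   (fun y => chart k (chart_inv a (rep F i a y))^-1%g)).
  by move=> y [[iy ay] [_ ky]]; rewrite /rep chartK.
apply: (Ck_comp_rV (g := fun x => chart k (chart_inv a x)^-1%g) oU' _ _ (inv_smooth a k d)).
- by apply: Ck_sub (Fs i a d) => y [].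
- move=> y [[iy ay] [_ ky]]; split=> /=; first exact: chart_img.
  by rewrite /rep chartK.
Qed.

Lemma smooth_left_mul p : smooth_map (left_mul p).
Proof. exact: smooth_map_mul (smooth_map_cst p) smooth_map_id. Qed.

Lemma rep_differentiable F i j x : smooth_map F -> rep_on F i j x ->
  differentiable (rep F i j) x.
Proof. by move=> [_ /(_ i j 1%N) [Fd _]] /Fd. Qed.

Lemma rep_near F i j x : smooth_map F -> rep_on F i j x ->
  \forall y \near x, rep_on F i j y.
Proof. by move=> [Fc _] h; apply: open_nbhs_nbhs; split => //; exact: open_rep_on. Qed.

Lemma rep_comp F G H i j k x : smooth_map F -> smooth_map G ->
  (forall p, H p = G (F p)) -> rep_on F i j x -> dom k (H (chart_inv i x)) ->
  is_diff x (rep H i k) (fun v => 'd (rep G j k) (rep F i j x) ('d (rep F i j) x v)).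
Proof.
move=> sF sG HE Fx Hx; have [ix jx] := Fx.
have Gx : rep_on G j k (rep F i j x).
  by split; [exact: chart_img|rewrite /rep chartK // -HE].
have := is_diff_comp (differentiableP (rep_differentiable sF Fx))
          (differentiableP (rep_differentiable sG Gx)).
apply: near_is_diff; apply: filterS (rep_near sF Fx) => y [iy jy].
by rewrite /= /rep chartK // HE.
Qed.

Lemma diff_rep_comp F G H i j k x v : smooth_map F -> smooth_map G ->
  (forall p, H p = G (F p)) -> rep_on F i j x -> dom k (H (chart_inv i x)) ->
  'd (rep H i k) x v = 'd (rep G j k) (rep F i j x) ('d (rep F i j) x v).
Proof.
move=> sF sG HE Fx Hx; have [_ e] := rep_comp sF sG HE Fx Hx.
exact: (congr1 (fun f : V -> V => f v) e).
Qed.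

Variable i0 : I.
Hypothesis dom1 : dom i0 1%g.
Let e0 : V := chart i0 1%g.
Let img_e0 : img i0 e0. Proof. exact: chart_img. Qed.
Let inv_e0 : chart_inv i0 e0 = 1%g. Proof. exact: chartK. Qed.

Definition linv (u : V) : vfield N :=
  fun i x => 'd (rep (left_mul (chart_inv i x)) i0 i) e0 u.

Lemma left_mul_on i x : img i x -> rep_on (left_mul (chart_inv i x)) i0 i e0.
Proof. by move=> ix; split; rewrite // inv_e0 /left_mul mulg1; exact: chart_inv_dom. Qed.

Lemma rep_left_mul_e0 i x : img i x -> rep (left_mul (chart_inv i x)) i0 i e0 = x.
Proof. by move=> ix; rewrite /rep inv_e0 /left_mul mulg1 chart_invK. Qed.

(** This form covers at once the identity, which gives the change of charts, and the left
    translations. *)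
Lemma linv_natural F u : smooth_map F -> (forall p q, F (p * q)%g = (F p * q)%g) ->
  vfield_invariant F (linv u).
Proof.
move=> sF FM i j x Fx; have [ix jx] := Fx; have on := left_mul_on ix.
rewrite /linv; have -> : chart_inv j (rep F i j x) = F (chart_inv i x).
  by rewrite /rep chartK.
have HE q : left_mul (F (chart_inv i x)) q = F (left_mul (chart_inv i x) q).
  by rewrite /left_mul FM.
have Hx : dom j (left_mul (F (chart_inv i x)) (chart_inv i0 e0)).
  by rewrite inv_e0 /left_mul mulg1.
apply: etrans (diff_rep_comp u (smooth_left_mul _) sF HE on Hx) _.
by rewrite rep_left_mul_e0.
Qed.

(** The field is a partial differential of the multiplication, in its second argument at the
    identity; one more order of smoothness of the multiplication is consumed. *)
Lemma linv_smooth u i : smooth (img i) (linv u i).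
Proof.
move=> k; have oi : open (img i) by exact: img_open.
have mS := mul_smooth i i0 i k.+1.
set m := fun xy : V * V => chart i (chart_inv i xy.1 * chart_inv i0 xy.2)%g in mS.
have [md mc] := mS.
have on x : img i x -> [/\ img i x, img i0 e0 & dom i (chart_inv i x * chart_inv i0 e0)%g].
  by move=> ix; split=> //; rewrite inv_e0 mulg1; exact: chart_inv_dom.
apply: (@Ck_ext _ _ _ oi _ _ (fun x => 'd m (x, e0) (0, u))).
  move=> x ix; have mx : differentiable m (x, e0) by apply: md; exact: on.
  have := is_diff_comp (is_diff_pair (is_diff_cst x e0) (is_diff_id e0)) (differentiableP mx).
  by move=> [_ /(congr1 (fun f => f u))].
apply: (Ck_comp_rV2 (g := fun z => 'd m z (0, u)) oi _ _ on (mc (0, u))).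
- exact: Ck_id.
- exact: Ck_cst.
Qed.

Lemma linv_left_invariant u : left_invariant_vfield (linv u).
Proof.
split; first split.
- exact: linv_smooth.
- by apply: linv_natural => //; exact: smooth_map_id.
- move=> a; apply: linv_natural; first exact: smooth_left_mul.
  by move=> p q; rewrite /left_mul mulgA.
Qed.

Lemma left_invariantE (Z : vfield N) i x : left_invariant_vfield Z -> img i x ->
  Z i x = linv (Z i0 e0) i x.
Proof.
move=> [_ Zi] ix; have := Zi (chart_inv i x) i0 i e0 (left_mul_on ix).
by rewrite rep_left_mul_e0.
Qed.

Lemma linv_e0 u : linv u i0 e0 = u.
Proof.
rewrite /linv inv_e0; have [] : is_diff e0 (rep (left_mul 1%g) i0 i0) id; last by move=> _ ->.
apply: (near_is_diff (f := id)) (is_diff_id e0).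
have oi : open (img i0) by exact: img_open.
apply: (open_near oi img_e0) => y iy.
by rewrite /rep /left_mul mul1g chart_invK.
Qed.

Lemma linvP a u v i x : linv (a *: u + v) i x = a *: linv u i x + linv v i x.
Proof. exact: linearP. Qed.

Lemma linv_sum m (c : 'I_m -> R) (u : 'I_m -> V) i x :
  linv (\sum_l c l *: u l) i x = \sum_l c l *: linv (u l) i x.
Proof. by rewrite /linv linear_sum; apply: eq_bigr => l _; exact: linearZ. Qed.

End LieGroup.

Section LocalBracket.
Variables (R : realType) (n : nat).
Local Notation V := 'rV[R]_n.
Variable U : set V.
Hypothesis oU : open U.

Lemma Ck_diff_app (W : normedModType R) k (f : V -> W) (A : V -> V) :
  Ck k.+1 U f -> Ck k U A -> Ck k U (fun x => 'd f x (A x)).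
Proof.
move=> [_ fc] Ac.
apply: (@Ck_ext _ _ _ oU _ _ (fun x => \sum_i A x ord0 i *: 'd f x (delta_mx ord0 i))).
  move=> x _; rewrite {2}(delta_mx_sum (A x)) linear_sum /=.
  by apply: eq_bigr => i _; rewrite linearZ.
by apply: Ck_sum => // i; apply: Ck_scale => //; [exact: Ck_coord|exact: fc].
Qed.

Lemma Ck_opp (W : normedModType R) k (f : V -> W) : Ck k U f -> Ck k U (fun x => - f x).
Proof.
move=> fc; apply: (Ck_ext oU) (Ck_scale oU (Ck_cst oU k (-1 : R^o)) fc) => x _.
by rewrite scaleN1r.
Qed.

Lemma smooth_local_bracket (A B : V -> V) : smooth U A -> smooth U B ->
  smooth U (local_bracket A B).
Proof.
move=> As Bs k; apply: CkD => //; first exact: Ck_diff_app (Bs k.+1) (As k).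
by apply: Ck_opp; exact: Ck_diff_app (As k.+1) (Bs k).
Qed.

Lemma is_diff_diff_app (W : normedModType R) (f : V -> W) (A : V -> V) x :
  U x -> Ck 2 U f -> differentiable A x ->
  is_diff x (fun y => 'd f y (A y))
    (fun w => 'd (fun y => 'd f y (A x)) x w + 'd f x ('d A x w)).
Proof.
move=> Ux [_ fc] Ad; apply: (is_diff_bilinear (B := fun y => 'd f y)) => //.
  by near=> y => a u v; rewrite linearP.
by move=> a; apply: (fc a).1.
Unshelve. all: by end_near. Qed.

(** Once expanded, the second-order terms cancel in pairs by the symmetry of second derivatives, and
    the compositions of first derivatives cancel formally. *)
Lemma local_bracket_jacobi (A B C : V -> V) x : U x ->
  smooth U A -> smooth U B -> smooth U C ->
  local_bracket A (local_bracket B C) x + local_bracket B (local_bracket C A) x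
  + local_bracket C (local_bracket A B) x = 0.
Proof.
move=> Ux As Bs Cs.
have dd (A' : V -> V) : smooth U A' -> differentiable A' x by move=> /(_ 1%N) [h _]; exact: h.
have E (B' C' : V -> V) w : smooth U B' -> smooth U C' -> 'd (local_bracket B' C') x w =
    'd (fun y => 'd C' y (B' x)) x w + 'd C' x ('d B' x w)
    - ('d (fun y => 'd B' y (C' x)) x w + 'd B' x ('d C' x w)).
  move=> Bs' Cs'; have h1 := is_diff_diff_app Ux (Cs' 2%N) (dd _ Bs').
  have h2 := is_diff_diff_app Ux (Bs' 2%N) (dd _ Cs').
  have [_ e] := is_diffB h1 h2.
  exact: (congr1 (fun f : V -> V => f w) e).
have L (A' B' C' : V -> V) : smooth U B' -> smooth U C' ->
    local_bracket A' (local_bracket B' C') x =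
    'd (fun y => 'd C' y (B' x)) x (A' x) + 'd C' x ('d B' x (A' x))
    - ('d (fun y => 'd B' y (C' x)) x (A' x) + 'd B' x ('d C' x (A' x)))
    - ('d A' x ('d C' x (B' x)) - 'd A' x ('d B' x (C' x))).
  move=> Bs' Cs'; rewrite -linearB.
  exact: (congr1 (fun z => z - 'd A' x (local_bracket B' C' x)) (E B' C' (A' x) Bs' Cs')).
rewrite (L A B C Bs Cs) (L B C A Cs As) (L C A B As Bs).
have s1 := Schwarz (A x) (C x) oU Ux (Bs 2%N).
have s2 := Schwarz (B x) (A x) oU Ux (Cs 2%N).
have s3 := Schwarz (C x) (B x) oU Ux (As 2%N).
have cancel (b_ac b_ca c_ba c_ab a_cb a_bc cba bca acb cab bac abc : V) :
    b_ac = b_ca -> c_ba = c_ab -> a_cb = a_bc ->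
    (c_ba + cba - (b_ca + bca) - (acb - abc))
    + (a_cb + acb - (c_ab + cab) - (bac - bca))
    + (b_ac + bac - (a_bc + abc) - (cba - cab)) = 0.
  by move=> -> -> ->; apply/rowP => i; rewrite !mxE; ring.
exact: (cancel _ _ _ _ _ _ _ _ _ _ _ _ s1 s2 s3).
Qed.

Lemma local_bracketC (A B : V -> V) x : local_bracket A B x = - local_bracket B A x.
Proof. by rewrite /local_bracket opprB. Qed.

Lemma near_local_bracket (A B A' B' : V -> V) x : U x ->
  (forall y, U y -> A y = A' y) -> (forall y, U y -> B y = B' y) ->
  differentiable A x -> differentiable B x ->
  local_bracket A B x = local_bracket A' B' x.
Proof.
move=> Ux AA BB Ad Bd; rewrite /local_bracket (AA x Ux) (BB x Ux).
have eA := near_diff (open_near oU Ux AA) Ad.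
have eB := near_diff (open_near oU Ux BB) Bd.
exact: (congr2 (fun f h : V -> V => f (A' x) - h (B' x)) (esym eB) (esym eA)).
Qed.

End LocalBracket.

(** * The Lie algebra of [N] on the tangent space at the identity *)

Section LieAlgebra.
Variables (R : realType) (n : nat) (N : lieGroup R n).
Local Notation V := 'rV[R]_n.
Local Notation I := (Defs.index (lie_atlas N)).
Variable i0 : I.
Hypothesis dom1 : dom i0 1%g.
Let e0 : V := chart i0 1%g.
Let img_e0 : img i0 e0. Proof. exact: chart_img. Qed.
Let oimg (i : I) : open (img i). Proof. exact: img_open. Qed.
Local Notation linv := (linv i0).

(** Differentiating the relations between the fields and [F] produces second derivatives of [rep F],
    which cancel in the bracket by symmetry. *)
Lemma bracket_natural (F : N -> N) (Y Z : vfield N) : smooth_map F ->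
  (forall i, smooth (img i) (Y i)) -> (forall i, smooth (img i) (Z i)) ->
  vfield_invariant F Y -> vfield_invariant F Z -> vfield_invariant F (bracket Y Z).
Proof.
move=> sF Ys Zs YF ZF i j x Fx; have [ix jx] := Fx.
have rs := sF.2 i j; have oF : open (rep_on F i j) by exact: open_rep_on sF.1.
have imgF : img j (rep F i j x) by exact: chart_img.
have dY (Z' : vfield N) w : (forall i, smooth (img i) (Z' i)) -> vfield_invariant F Z' ->
    'd (Z' j) (rep F i j x) ('d (rep F i j) x w) =
    'd (fun y => 'd (rep F i j) y (Z' i x)) x w + 'd (rep F i j) x ('d (Z' i) x w).
  move=> Zs' ZF'.
  have h1 := is_diff_comp (differentiableP (rep_differentiable sF Fx))
               (differentiableP ((Zs' j 1%N).1 _ imgF)).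
  have h2 := is_diff_diff_app Fx (rs 2%N) ((Zs' i 1%N).1 _ ix).
  have h3 := near_is_diff
     (open_near oF Fx (fun y Fy => esym (ZF' i j y Fy))) h2.
  have [_ e1] := h1; have [_ e3] := h3.
  exact: (congr1 (fun f : V -> V => f w) (etrans (esym e1) e3)).
rewrite /bracket /local_bracket (YF _ _ _ Fx) (ZF _ _ _ Fx).
have s := Schwarz (Z i x) (Y i x) oF Fx (rs 2%N).
have eY := dY Y (Z i x) Ys YF; have eZ := dY Z (Y i x) Zs ZF.
apply: etrans (congr2 (fun a b : V => a - b) eZ eY) _.
have lB := linearB ('d (rep F i j) x) ('d (Z i) x (Y i x)) ('d (Y i) x (Z i x)).
have cancel (a b c d e : V) : a = c -> e = b - d -> a + b - (c + d) = e.
  by move=> -> ->; apply/rowP => l; rewrite !mxE; ring.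
exact: cancel s lB.
Qed.

Lemma bracket_left_invariant (Y Z : vfield N) : left_invariant_vfield Y ->
  left_invariant_vfield Z -> left_invariant_vfield (bracket Y Z).
Proof.
move=> [[Ys Y1] Yi] [[Zs Z1] Zi]; split; first split.
- by move=> i; apply: smooth_local_bracket.
- exact: bracket_natural (smooth_map_id N) _ _ _ _.
- by move=> a; apply: bracket_natural => //; exact: smooth_left_mul.
Qed.

Definition lie (u v : V) : V := bracket (linv u) (linv v) i0 e0.

Lemma bracket_linv u v i x : img i x ->
  bracket (linv u) (linv v) i x = linv (lie u v) i x.
Proof.
move=> ix; apply: left_invariantE => //.
by apply: bracket_left_invariant; exact: linv_left_invariant.
Qed.

Lemma linv_differentiable u i x : img i x -> differentiable (linv u i) x.
Proof. by move=> ix; apply: (linv_smooth dom1 u i 1%N).1. Qed.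

Lemma lieC u v : lie u v = - lie v u.
Proof. exact: local_bracketC. Qed.

Lemma lie_linear u : linear (lie u).
Proof.
move=> a v w; rewrite /lie /bracket /local_bracket !linv_e0 //.
have -> : linv (a *: v + w) i0 = (a *: (linv v i0 : V -> V) + (linv w i0 : V -> V)).
  by apply/funext => y; rewrite linvP.
have dv := differentiableP (linv_differentiable v img_e0).
have dw := differentiableP (linv_differentiable w img_e0).
have [_ e] := is_diffD (is_diffZ a dv) dw.
have eu := congr1 (fun f : V -> V => f u) e.
have cancel (x y p q r s : V) : x = a *: p + q -> y = a *: r + s ->
    x - y = a *: (p - r) + (q - s).
  by move=> -> ->; apply/rowP => l; rewrite !mxE; ring.
exact: (cancel _ _ _ _ _ _ eu (linearP _ a v w)).
Qed.

Lemma lie_jacobi u v w : lie u (lie v w) + lie v (lie w u) + lie w (lie u v) = 0.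
Proof.
have E a b c : lie a (lie b c) =
    local_bracket (linv a i0) (local_bracket (linv b i0) (linv c i0)) e0.
  rewrite -[lie a (lie b c)]/(local_bracket (linv a i0) (linv (lie b c) i0) e0).
  apply: (near_local_bracket (@oimg i0) img_e0) => //.
  - by move=> y iy; rewrite -(bracket_linv _ _ iy).
  - exact: linv_differentiable.
  - exact: linv_differentiable.
rewrite (E u v w) (E v w u) (E w u v).
apply: (local_bracket_jacobi (@oimg i0) img_e0); exact: linv_smooth.
Qed.

End LieAlgebra.

(** * Forms and their type decomposition *)

Definition vec3 (T : Type) (a b c : T) : 'I_3 -> T := fun l => nth a [:: a; b; c] l.
Definition vec4 (T : Type) (a b c d : T) : 'I_4 -> T := fun l => nth a [:: a; b; c; d] l.

(** Encoding sets of slots by booleans turns the sums of [type_part] into explicit finite sums. *)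
Definition bits (s : seq bool) k : {set 'I_k} := [set l : 'I_k | nth false s l].

Lemma sum_set3 (M : zmodType) (F : {set 'I_3} -> M) :
  \sum_A F A = \sum_(a : bool) \sum_(b : bool) \sum_(c : bool) F (bits [:: a; b; c] 3).
Proof.
pose f (t : bool * bool * bool) := bits [:: t.1.1; t.1.2; t.2] 3.
pose o (i : nat) (h : (i < 3)%N) : 'I_3 := Ordinal h.
pose h (A : {set 'I_3}) : bool * bool * bool :=
  (o 0 isT \in A, o 1 isT \in A, o 2 isT \in A)%N.
rewrite (reindex f) /=.
  by rewrite pair_big pair_big /=; apply: eq_bigl => -[[a b] c].
exists h => [[[a b] c] _|A _]; first by rewrite /h /f /= !inE.
apply/setP => -[[|[|[|//]]] i]; rewrite /f /h !inE /=; congr (_ \in A); exact: val_inj.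
Qed.

Lemma sum_set4 (M : zmodType) (F : {set 'I_4} -> M) :
  \sum_A F A = \sum_(a : bool) \sum_(b : bool) \sum_(c : bool) \sum_(d : bool)
    F (bits [:: a; b; c; d] 4).
Proof.
pose f (t : bool * bool * bool * bool) := bits [:: t.1.1.1; t.1.1.2; t.1.2; t.2] 4.
pose o (i : nat) (h : (i < 4)%N) : 'I_4 := Ordinal h.
pose h (A : {set 'I_4}) : bool * bool * bool * bool :=
  (o 0 isT \in A, o 1 isT \in A, o 2 isT \in A, o 3 isT \in A)%N.
rewrite (reindex f) /=.
  by rewrite pair_big pair_big pair_big /=; apply: eq_bigl => -[[[a b] c] d].
exists h => [[[[a b] c] d] _|A _]; first by rewrite /h /f /= !inE.
apply/setP => -[[|[|[|[|//]]]] i]; rewrite /f /h !inE /=; congr (_ \in A); exact: val_inj.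
Qed.

Section TypePart.
Variables (R : realType) (n : nat).
Local Notation V := 'rV[R]_n.
Implicit Types (J : V -> V -> V) (a b c d : V).

Lemma card_bits k (s : seq bool) : #|bits s k| = (\sum_(l < k) nth false s l)%N.
Proof.
by rewrite -sum1_card big_mkcond; apply: eq_bigr => l _; rewrite inE; case: nth.
Qed.

Lemma prod_bits k (s t : seq bool) (x y : R[i]) :
  \prod_(l in bits s k) (if l \in bits t k then x else y) =
  \prod_(l < k) (if nth false s l then if nth false t l then x else y else 1).
Proof.
by rewrite big_mkcond; apply: eq_bigr => l _; rewrite !inE.
Qed.

Lemma vec3_if (T : Type) (f : T -> T) s t u (a b c : T) :
  (fun l => if l \in bits [:: s; t; u] 3 then f (vec3 a b c l) else vec3 a b c l) =
  vec3 (if s then f a else a) (if t then f b else b) (if u then f c else c).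
Proof. by apply/funext => -[[|[|[|//]]] i]; rewrite !inE /=. Qed.

Lemma vec4_if (T : Type) (f : T -> T) s t u w (a b c d : T) :
  (fun l => if l \in bits [:: s; t; u; w] 4 then f (vec4 a b c d l) else vec4 a b c d l) =
  vec4 (if s then f a else a) (if t then f b else b) (if u then f c else c)
       (if w then f d else d).
Proof. by apply/funext => -[[|[|[|[|//]]]] i]; rewrite !inE /=. Qed.

Let ii : 'i%C * 'i%C = -1 :> R[i].
Proof. by apply/eqP; rewrite eq_complex /=; apply/andP; split; apply/eqP; ring. Qed.

Lemma type_part3E J (alpha : Defs.form R n 3) x a b c :
  type_part J 1 alpha x (vec3 a b c) =
  (2%:R ^+ 3)^-1 * (3%:R * alpha x (vec3 a b c) + alpha x (vec3 (J x a) (J x b) c)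
    + alpha x (vec3 (J x a) b (J x c)) + alpha x (vec3 a (J x b) (J x c))
    + 'i%C * (alpha x (vec3 (J x a) b c) + alpha x (vec3 a (J x b) c)
       + alpha x (vec3 a b (J x c)) + 3%:R * alpha x (vec3 (J x a) (J x b) (J x c)))).
Proof.
rewrite /type_part big_mkcond sum_set3 !big_bool.
rewrite !card_bits !big_ord_recl !big_ord0 /=.
rewrite !sum_set3 !big_bool !prod_bits !big_ord_recl !big_ord0 /= !vec3_if.
rewrite -[Complex 0 1]/'i%C; do ?rewrite !(mulr1, mul1r, mulrN, mulNr, opprK) ?ii.
move: ((2 ^+ 3)^-1) 'i%C => e i; ring.
Qed.

(** The coefficient, in the (2,2) part, of the term with [J] in a given set of slots. For an odd
    number of slots, [S] and its complement cancel. For two slots, the four [S] that separate them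
    give 1 each and the two others -1, in total 2. For none or all four, each of the six [S] gives
    1. *)
Lemma coef4 s t u w :
  \sum_(S : {set 'I_4} | #|S| == 2%N)
    \prod_(l in bits [:: s; t; u; w] 4) (if l \in S then - 'i%C else 'i%C) =
  (if odd (s + t + u + w) then 0 else if (s + t + u + w == 2)%N then 2 else 6)%:R :> R[i].
Proof.
rewrite big_mkcond sum_set4 !big_bool !card_bits !big_ord_recl !big_ord0 /=.
rewrite !prod_bits !big_ord_recl !big_ord0 /=.
case: s; case: t; case: u; case: w => /=;
  do ?rewrite !(mulr1, mul1r, mulrN, mulNr, opprK) ?ii; ring.
Qed.

Lemma type_part4E J (alpha : Defs.form R n 4) x a b c d :
  type_part J 2 alpha x (vec4 a b c d) =
  (2%:R ^+ 4)^-1 * (6%:R * alpha x (vec4 a b c d)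
    + 2%:R * (alpha x (vec4 (J x a) (J x b) c d) + alpha x (vec4 (J x a) b (J x c) d)
      + alpha x (vec4 (J x a) b c (J x d)) + alpha x (vec4 a (J x b) (J x c) d)
      + alpha x (vec4 a (J x b) c (J x d)) + alpha x (vec4 a b (J x c) (J x d)))
    + 6%:R * alpha x (vec4 (J x a) (J x b) (J x c) (J x d))).
Proof.
rewrite /type_part exchange_big /=.
under eq_bigr => A _ do rewrite -big_distrl -big_distrr /=.
rewrite sum_set4 !big_bool -[Complex 0 1]/'i%C !coef4 !vec4_if /=.
move: ((2 ^+ 4)^-1) => e; ring.
Qed.

End TypePart.

(** * Real form of the SKT condition *)

Section ExteriorDerivative.
Variables (R : realType) (n : nat).
Local Notation V := 'rV[R]_n.

Definition vec2 (T : Type) (a b : T) : 'I_2 -> T := fun l => nth a [:: a; b] l.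

Lemma ext_d2E (alpha : Defs.form R n 2) x a b c :
  ext_d alpha x (vec3 a b c) =
  cderive (fun y => alpha y (vec2 b c)) x a - cderive (fun y => alpha y (vec2 a c)) x b
  + cderive (fun y => alpha y (vec2 a b)) x c.
Proof.
rewrite /ext_d !big_ord_recl big_ord0.
have alt (p q r : R[i]) : (-1) ^+ 0 * p + ((-1) ^+ 1 * q + ((-1) ^+ 2 * r + 0)) = p - q + r.
  by ring.
apply: etrans (alt _ _ _) _.
have e0 : (fun m : 'I_2 => vec3 a b c (lift ord0 m)) = vec2 b c.
  by apply/funext => -[[|[|//]]] i.
have e1 : (fun m : 'I_2 => vec3 a b c (lift (lift ord0 ord0) m)) = vec2 a c.
  by apply/funext => -[[|[|//]]] i.
have e2 : (fun m : 'I_2 => vec3 a b c (lift (lift ord0 (lift ord0 ord0)) m)) = vec2 a b.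
  by apply/funext => -[[|[|//]]] i.
by rewrite e0 e1 e2.
Qed.

Lemma ext_d3E (alpha : Defs.form R n 3) x a b c d :
  ext_d alpha x (vec4 a b c d) =
  cderive (fun y => alpha y (vec3 b c d)) x a - cderive (fun y => alpha y (vec3 a c d)) x b
  + cderive (fun y => alpha y (vec3 a b d)) x c - cderive (fun y => alpha y (vec3 a b c)) x d.
Proof.
rewrite /ext_d !big_ord_recl big_ord0.
have alt (p q r s : R[i]) :
    (-1) ^+ 0 * p + ((-1) ^+ 1 * q + ((-1) ^+ 2 * r + ((-1) ^+ 3 * s + 0))) = p - q + r - s.
  by ring.
apply: etrans (alt _ _ _ _) _.
have e0 : (fun m : 'I_3 => vec4 a b c d (lift ord0 m)) = vec3 b c d.
  by apply/funext => -[[|[|[|//]]]] i.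
have e1 : (fun m : 'I_3 => vec4 a b c d (lift (lift ord0 ord0) m)) = vec3 a c d.
  by apply/funext => -[[|[|[|//]]]] i.
have e2 : (fun m : 'I_3 => vec4 a b c d (lift (lift ord0 (lift ord0 ord0)) m)) = vec3 a b d.
  by apply/funext => -[[|[|[|//]]]] i.
have e3 : (fun m : 'I_3 => vec4 a b c d (lift (lift ord0 (lift ord0 (lift ord0 ord0))) m))
    = vec3 a b c.
  by apply/funext => -[[|[|[|//]]]] i.
by rewrite e0 e1 e2 e3.
Qed.

Definition dform2 (w : V -> V -> V -> R) (y a b c : V) : R :=
  'd (fun z => w z b c : R^o) y a - 'd (fun z => w z a c : R^o) y b
  + 'd (fun z => w z a b : R^o) y c.

Definition dform3 (w : V -> V -> V -> V -> R) (y a b c d : V) : R :=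
  'd (fun z => w z b c d : R^o) y a - 'd (fun z => w z a c d : R^o) y b
  + 'd (fun z => w z a b d : R^o) y c - 'd (fun z => w z a b c : R^o) y d.

Lemma cderive_real (r : V -> R) x v :
  cderive (fun y => Complex (r y) 0) x v = Complex ('d (r : V -> R^o) x v) 0.
Proof.
rewrite /cderive /=; congr Complex.
exact: (congr1 (fun f : V -> R^o => f v) (diff_cst (0 : R^o) x)).
Qed.

Variables (J : V -> V -> V) (g : V -> V -> V -> R).

Definition omega y a b := g y (J y a) b.
Definition domega := dform2 omega.

Lemma ext_d_fundamental x a b c :
  ext_d (fundamental_form J g) x (vec3 a b c) = Complex (domega x a b c) 0.
Proof.
rewrite ext_d2E.
rewrite -[cderive (fun y => _ (vec2 b c)) _ _]/(cderive (fun y => Complex (omega y b c) 0) x a).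
rewrite -[cderive (fun y => _ (vec2 a c)) _ _]/(cderive (fun y => Complex (omega y a c) 0) x b).
rewrite -[cderive (fun y => _ (vec2 a b)) _ _]/(cderive (fun y => Complex (omega y a b) 0) x c).
rewrite !cderive_real; congr Complex => /=; by rewrite oppr0 !addr0.
Qed.

(** The part with coefficient [i] of the (1,2) projection in [type_part3E], applied to the real form
    [domega]. *)
Definition Im_delbar y a b c :=
  (2%:R ^+ 3)^-1 * (domega y (J y a) b c + domega y a (J y b) c + domega y a b (J y c)
    + 3%:R * domega y (J y a) (J y b) (J y c)).

Lemma ImD (z w : R[i]) : complex.Im (z + w) = complex.Im z + complex.Im w.
Proof. by case: z w => [? ?] [? ?]. Qed.
Lemma ImN (z : R[i]) : complex.Im (- z) = - complex.Im z.
Proof. by case: z. Qed.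
Lemma ImZ (r : R) (z : R[i]) : complex.Im (r%:C%C * z) = r * complex.Im z.
Proof. by case: z => a b /=; rewrite mul0r addr0. Qed.

Lemma Im_delbarE x a b c :
  complex.Im (delbar J 1 (fundamental_form J g) x (vec3 a b c)) = Im_delbar x a b c.
Proof.
rewrite /delbar type_part3E !ext_d_fundamental.
have -> : (2%:R ^+ 3)^-1 = ((2%:R ^+ 3)^-1)%:C%C :> R[i].
  by rewrite fmorphV rmorphXn rmorph_nat.
have -> : 3%:R = (3%:R)%:C%C :> R[i] by rewrite rmorph_nat.
rewrite ImZ !ImD !ImZ /= ?mulr0 !add0r !mul0r !mul1r !add0r.
rewrite /Im_delbar; congr (_ * _).
move: (domega x (J x a) b c) (domega x a (J x b) c) (domega x a b (J x c)).
by move: (domega x (J x a) (J x b) (J x c)) => p q r s; ring.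
Qed.

(** The (2,2) projection has real coefficients, so it commutes with taking imaginary parts. *)
Lemma SKT_real x : (forall v : 'I_4 -> V,
    del J 1 (delbar J 1 (fundamental_form J g)) x v = 0) ->
  forall a b c d,
  6%:R * dform3 Im_delbar x a b c d
  + 2%:R * (dform3 Im_delbar x (J x a) (J x b) c d + dform3 Im_delbar x (J x a) b (J x c) d
      + dform3 Im_delbar x (J x a) b c (J x d) + dform3 Im_delbar x a (J x b) (J x c) d
      + dform3 Im_delbar x a (J x b) c (J x d) + dform3 Im_delbar x a b (J x c) (J x d))
  + 6%:R * dform3 Im_delbar x (J x a) (J x b) (J x c) (J x d) = 0.
Proof.
move=> h a b c d; have := congr1 (@complex.Im R) (h (vec4 a b c d)).
rewrite /del type_part4E.
have -> : (2%:R ^+ 4)^-1 = ((2%:R ^+ 4)^-1)%:C%C :> R[i].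
  by rewrite fmorphV rmorphXn rmorph_nat.
have -> : 6%:R = (6%:R)%:C%C :> R[i] by rewrite rmorph_nat.
have -> : 2%:R = (2%:R)%:C%C :> R[i] by rewrite rmorph_nat.
have E p q r s : complex.Im (ext_d (delbar J 1 (fundamental_form J g)) x (vec4 p q r s))
    = dform3 Im_delbar x p q r s.
  have cE p' q' r' v :
    complex.Im (cderive (fun y => delbar J 1 (fundamental_form J g) y (vec3 p' q' r')) x v)
     = 'd (fun z => Im_delbar z p' q' r' : R^o) x v.
    rewrite /cderive /=; congr ('d _ x v); apply/funext => y; exact: Im_delbarE.
  by rewrite ext_d3E !ImD !ImN !cE.
rewrite ImZ !ImD !ImZ !ImD !E => /eqP; rewrite mulf_eq0 => /orP[|/eqP//].
by rewrite invr_eq0 expf_eq0 /= pnatr_eq0.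
Qed.

End ExteriorDerivative.

Lemma linear_opp (R : nzRingType) (V W : lmodType R) (f : V -> W) :
  linear f -> forall v, f (- v) = - f v.
Proof.
move=> lf v; pose FM := GRing.isLinear.Build _ _ _ _ _ lf.
pose F : {linear V -> W} := HB.pack f FM; exact: (linearN F).
Qed.

(** * Exterior derivatives in a frame with constant structure *)

Section Leibniz.
Variables (R : realType) (n : nat).
Local Notation V := 'rV[R]_n.
Variable U : set V.
Hypothesis oU : open U.

Lemma is_diff_bilinear2 (B : V -> V -> V -> R^o) (A1 A2 : V -> V) x : U x ->
  (forall y, U y -> forall a, linear (B y a)) ->
  (forall y, U y -> forall b, linear (fun a => B y a b)) ->
  (forall a b, differentiable (fun y => B y a b) x) ->
  differentiable A1 x -> differentiable A2 x ->
  is_diff x (fun y => B y (A1 y) (A2 y))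
    (fun w => 'd (fun y => B y (A1 x) (A2 x)) x w
              + B x ('d A1 x w) (A2 x) + B x (A1 x) ('d A2 x w)).
Proof.
move=> Ux Br Bl Bd A1d A2d.
have h2 a := is_diff_bilinear (open_near oU Ux (fun y Uy => Br y Uy a)) (Bd a) A2d.
have l1 : \forall y \near x, linear (fun a => B y a (A2 y)).
  by apply: open_near Ux _ => // y Uy; exact: Bl.
have h1 := is_diff_bilinear (B := fun y a => B y a (A2 y)) l1
  (fun a => @ex_diff _ _ _ _ _ _ _ (h2 a)) A1d.
move: h1 => /is_diff_eq; apply; apply/funext => w.
have [_ e] := h2 (A1 x).
apply: etrans (congr1 (fun z : R => z + B x ('d A1 x w) (A2 x))
  (congr1 (fun f : V -> R^o => f w) e)) _.
by rewrite addrAC.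
Qed.

Lemma is_diff_trilinear (B : V -> V -> V -> V -> R^o) (A1 A2 A3 : V -> V) x : U x ->
  (forall y, U y -> forall a b, linear (B y a b)) ->
  (forall y, U y -> forall a c, linear (fun b => B y a b c)) ->
  (forall y, U y -> forall b c, linear (fun a => B y a b c)) ->
  (forall a b c, differentiable (fun y => B y a b c) x) ->
  differentiable A1 x -> differentiable A2 x -> differentiable A3 x ->
  is_diff x (fun y => B y (A1 y) (A2 y) (A3 y))
    (fun w => 'd (fun y => B y (A1 x) (A2 x) (A3 x)) x w
       + B x ('d A1 x w) (A2 x) (A3 x) + B x (A1 x) ('d A2 x w) (A3 x)
       + B x (A1 x) (A2 x) ('d A3 x w)).
Proof.
move=> Ux B3 B2 B1 Bd A1d A2d A3d.
have h3 a b := is_diff_bilinear (open_near oU Ux (fun y Uy => B3 y Uy a b)) (Bd a b) A3d.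
have h12 := @is_diff_bilinear2 (fun y a b => B y a b (A3 y)) A1 A2 x Ux
  (fun y Uy a => B2 y Uy a (A3 y)) (fun y Uy b => B1 y Uy b (A3 y))
  (fun a b => @ex_diff _ _ _ _ _ _ _ (h3 a b)) A1d A2d.
move: h12 => /is_diff_eq; apply; apply/funext => w.
have [_ e] := h3 (A1 x) (A2 x).
apply: etrans (congr1 (fun z : R => z + B x ('d A1 x w) (A2 x) (A3 x)
  + B x (A1 x) ('d A2 x w) (A3 x))
   (congr1 (fun f : V -> R^o => f w) e)) _.
have ar (p q r s : R) : p + q + r + s = p + r + s + q by ring.
exact: ar.
Qed.

End Leibniz.

Section Frame.
Variables (R : realType) (n : nat).
Local Notation V := 'rV[R]_n.
Variable U : set V.
Hypothesis oU : open U.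
Variables (X : V -> V -> V) (b : V -> V -> V).
Hypothesis X_diff : forall u x, U x -> differentiable (X u) x.
Hypothesis X_bracket : forall u v x, U x -> local_bracket (X u) (X v) x = X (b u v) x.

(** [dform2] freezes its vectors at [x]. As [w] is constant on the frame, the derivative of [w] on
    frozen vectors is minus the terms where the frame fields are differentiated; skew-symmetry
    groups these into brackets. *)
Lemma dform2_frame (w : V -> V -> V -> R) (w0 : V -> V -> R) x u0 u1 u2 : U x ->
  (forall y, U y -> forall a, linear (w y a : V -> R^o)) ->
  (forall y, U y -> forall c, linear (fun a => w y a c : R^o)) ->
  (forall y, U y -> forall a c, w y a c = - w y c a) ->
  (forall a c, differentiable (fun y => w y a c : R^o) x) ->
  (forall y, U y -> forall u v, w y (X u y) (X v y) = w0 u v) ->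
  dform2 w x (X u0 x) (X u1 x) (X u2 x) =
  - w0 (b u0 u1) u2 + w0 (b u0 u2) u1 - w0 (b u1 u2) u0.
Proof.
move=> Ux wr wl wa wd wX.
have E u v p : 'd (fun y => w y (X u x) (X v x) : R^o) x p =
    - w x ('d (X u) x p) (X v x) - w x (X u x) ('d (X v) x p).
  have h := is_diff_bilinear2 (B := w) oU Ux wr wl wd (X_diff u Ux) (X_diff v Ux).
  have c : is_diff x (fun y => w y (X u y) (X v y) : R^o) 0.
    apply: near_is_diff (is_diff_cst (w0 u v : R^o) x).
    by apply: open_near Ux _ => // y Uy; rewrite wX.
  have [_ e1] := h; have [_ e2] := c.
  have := congr1 (fun f : V -> R^o => f p) (etrans (esym e1) e2).
  have ar (r1 r2 r3 : R) : r1 + r2 + r3 = 0 -> r1 = - r2 - r3 by lra.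
  exact: ar.
have [D DE] : exists D : V -> V -> V, forall u v, 'd (X v) x (X u x) = D u v.
  by exists (fun u v => 'd (X v) x (X u x)).
have B u v c : w x (D u v) c - w x (D v u) c = w x (X (b u v) x) c.
  rewrite -X_bracket // (_ : local_bracket _ _ _ = D u v - D v u); last first.
    by rewrite /local_bracket -!DE.
  have := wl x Ux c (-1) (D v u) (D u v).
  by rewrite scaleN1r scaleN1r addrC => <-; rewrite addrC.
have E' p u v : 'd (fun y => w y (X u x) (X v x) : R^o) x (X p x) =
    - w x (D p u) (X v x) - w x (X u x) (D p v).
  by rewrite -!DE; exact: E.
have cg (p q r p' q' r' : R) : p = p' -> q = q' -> r = r' -> p - q + r = p' - q' + r'.
  by move=> -> -> ->.
apply: etrans (cg _ _ _ _ _ _ (E' u0 u1 u2) (E' u1 u0 u2) (E' u2 u0 u1)) _.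
rewrite -!(wX x Ux) -!B.
by rewrite (wa x Ux (X u1 x)) !(wa x Ux (X u0 x)); ring.
Qed.

Lemma dform3_frame (w : V -> V -> V -> V -> R) (w0 : V -> V -> V -> R) x u0 u1 u2 u3 :
  U x ->
  (forall y, U y -> forall a c, linear (w y a c : V -> R^o)) ->
  (forall y, U y -> forall a c d, w y a c d = - w y c a d) ->
  (forall y, U y -> forall a c d, w y a c d = - w y a d c) ->
  (forall a c d, differentiable (fun y => w y a c d : R^o) x) ->
  (forall y, U y -> forall u v t, w y (X u y) (X v y) (X t y) = w0 u v t) ->
  dform3 w x (X u0 x) (X u1 x) (X u2 x) (X u3 x) =
  - w0 (b u0 u1) u2 u3 + w0 (b u0 u2) u1 u3 - w0 (b u0 u3) u1 u2
  - w0 (b u1 u2) u0 u3 + w0 (b u1 u3) u0 u2 - w0 (b u2 u3) u0 u1.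
Proof.
move=> Ux w3 wa12 wa23 wd wX.
have w2 y : U y -> forall a c, linear (fun d => w y a d c : R^o).
  move=> Uy a c k p q; rewrite !(wa23 y Uy a _ c) w3 //.
  by rewrite opprD -scalerN.
have w1 y : U y -> forall a c, linear (fun d => w y d a c : R^o).
  move=> Uy a c k p q; rewrite !(wa12 y Uy _ a) w2 //.
  by rewrite opprD -scalerN.
have E u v t p : 'd (fun y => w y (X u x) (X v x) (X t x) : R^o) x p =
    - w x ('d (X u) x p) (X v x) (X t x) - w x (X u x) ('d (X v) x p) (X t x)
    - w x (X u x) (X v x) ('d (X t) x p).
  have h := is_diff_trilinear (B := w) oU Ux w3 w2 w1 wd (X_diff u Ux) (X_diff v Ux) (X_diff t Ux).
  have c : is_diff x (fun y => w y (X u y) (X v y) (X t y) : R^o) 0.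
    apply: near_is_diff (is_diff_cst (w0 u v t : R^o) x).
    by apply: open_near Ux _ => // y Uy; rewrite wX.
  have [_ e1] := h; have [_ e2] := c.
  have := congr1 (fun f : V -> R^o => f p) (etrans (esym e1) e2).
  have ar (r1 r2 r3 r4 : R) : r1 + r2 + r3 + r4 = 0 -> r1 = - r2 - r3 - r4 by lra.
  exact: ar.
have [D DE] : exists D : V -> V -> V, forall u v, 'd (X v) x (X u x) = D u v.
  by exists (fun u v => 'd (X v) x (X u x)).
have B u v c d : w x (D u v) c d - w x (D v u) c d = w x (X (b u v) x) c d.
  rewrite -X_bracket // (_ : local_bracket _ _ _ = D u v - D v u); last first.
    by rewrite /local_bracket -!DE.
  have := w1 x Ux c d (-1) (D v u) (D u v).
  by rewrite scaleN1r scaleN1r addrC => <-; rewrite addrC.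
have E' p u v t : 'd (fun y => w y (X u x) (X v x) (X t x) : R^o) x (X p x) =
    - w x (D p u) (X v x) (X t x) + w x (D p v) (X u x) (X t x) - w x (D p t) (X u x) (X v x).
  have ar (p1 q1 q2 r1 r2 r3 : R) : q1 = - q2 -> r1 = - r2 -> r2 = - r3 ->
      - p1 - q1 - r1 = - p1 + q2 - r3 by move=> -> -> ->; ring.
  rewrite -!DE; apply: etrans (E u v t (X p x)) _.
  exact: (ar _ _ _ _ _ _ (wa12 x Ux _ _ _) (wa23 x Ux _ _ _) (wa12 x Ux _ _ _)).
have cg (p q r s p' q' r' s' : R) : p = p' -> q = q' -> r = r' -> s = s' ->
    p - q + r - s = p' - q' + r' - s'.
  by move=> -> -> -> ->.
apply: etrans (cg _ _ _ _ _ _ _ _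
  (E' u0 u1 u2 u3) (E' u1 u0 u2 u3) (E' u2 u0 u1 u3) (E' u3 u0 u1 u2)) _.
by rewrite -!(wX x Ux) -!B; ring.
Qed.

End Frame.

(** * The torsion in a frame adapted to [J] and [g] *)

Section HermitianFrame.
Variables (R : realType) (n : nat).
Local Notation V := 'rV[R]_n.
Variable U : set V.
Hypothesis oU : open U.
Variables (J : V -> V -> V) (g : V -> V -> V -> R).
Hypothesis J_linear : forall x, U x -> linear (J x).
Hypothesis J_smooth : forall v, smooth U (fun x => J x v).
Hypothesis JK : forall x, U x -> forall v, J x (J x v) = - v.
Hypothesis g_linear : forall x, U x -> forall u, linear (g x u : V -> R^o).
Hypothesis g_smooth : forall u v, smooth U (fun x => g x u v : R^o).
Hypothesis gC : forall x, U x -> forall u v, g x u v = g x v u.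
Hypothesis gJ : forall x, U x -> forall u v, g x (J x u) (J x v) = g x u v.

Let w := omega J g.

Let w_linear x : U x -> forall a, linear (w x a : V -> R^o).
Proof. by move=> Ux a; exact: g_linear. Qed.

Let w_alt x : U x -> forall a c, w x a c = - w x c a.
Proof.
move=> Ux a c; rewrite /w /omega -(gJ Ux (J x a) c) JK // gC //.
exact: linear_opp (g_linear Ux _) a.
Qed.

Let w_linearl x : U x -> forall c, linear (fun a => w x a c : R^o).
Proof.
move=> Ux c k p q; rewrite !(w_alt Ux _ c) w_linear //.
by rewrite opprD -scalerN.
Qed.

Let w_smooth a c : smooth U (fun y => w y a c : R^o).
Proof.
move=> k.
apply: (@Ck_ext _ _ _ oU _ _ (fun y => \sum_i (J y a) ord0 i *: (g y (delta_mx ord0 i) c : R^o))).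
  move=> y Uy; rewrite /w /omega gC // {2}(delta_mx_sum (J y a)).
  pose GM := GRing.isLinear.Build _ _ _ _ _ (g_linear Uy c).
  pose G : {linear V -> R^o} := HB.pack (g y c : V -> R^o) GM.
  rewrite -[g y c]/(G : V -> R^o) linear_sum.
  by apply: eq_bigr => i _; rewrite linearZ /= gC.
apply: Ck_sum => // i; apply: Ck_scale => //.
  by apply: Ck_coord => //; exact: J_smooth.
exact: g_smooth.
Qed.

Let w_diff a c x : U x -> differentiable (fun y => w y a c : R^o) x.
Proof. exact: (w_smooth a c 1%N).1. Qed.

Let dw := domega J g.

Let dw_alt12 x : U x -> forall a b c, dw x a b c = - dw x b a c.
Proof.
move=> Ux a b c; rewrite /dw /domega /dform2.
have e : 'd (fun y => omega J g y b a : R^o) x c = - 'd (fun y => omega J g y a b : R^o) x c.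
  have h := is_diffN (differentiableP (w_diff a b Ux)).
  have h' := near_is_diff (open_near oU Ux (fun y Uy => esym (w_alt Uy b a))) h.
  have [_ e] := h'.
  exact: (congr1 (fun f : V -> R^o => f c) e).
have ar (p q r s : R) : r = - s -> p - q + s = - (q - p + r) by move=> ->; ring.
exact: ar e.
Qed.

Let dw_alt23 x : U x -> forall a b c, dw x a b c = - dw x a c b.
Proof.
move=> Ux a b c; rewrite /dw /domega /dform2.
have e : 'd (fun y => omega J g y c b : R^o) x a = - 'd (fun y => omega J g y b c : R^o) x a.
  have h := is_diffN (differentiableP (w_diff b c Ux)).
  have h' := near_is_diff (open_near oU Ux (fun y Uy => esym (w_alt Uy c b))) h.
  have [_ e] := h'.
  exact: (congr1 (fun f : V -> R^o => f a) e).
have ar (p q r s : R) : s = - r -> r - q + p = - (s - p + q) by move=> ->; ring.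
exact: ar e.
Qed.

Let dw_linear3 x : U x -> forall a b, linear (dw x a b : V -> R^o).
Proof.
move=> Ux a b k c c'; rewrite /dw /domega /dform2.
have e z : 'd (fun y => omega J g y z (k *: c + c') : R^o) x =
    k *: ('d (fun y => omega J g y z c : R^o) x : V -> R^o)
    + ('d (fun y => omega J g y z c' : R^o) x : V -> R^o) :> (V -> R^o).
  have h := is_diffD (is_diffZ k (differentiableP (w_diff z c Ux)))
                     (differentiableP (w_diff z c' Ux)).
  have h' := near_is_diff (open_near oU Ux (fun y Uy => esym (w_linear Uy z k c c'))) h.
  by have [_ e] := h'.
have ar (p q r p1 q1 r1 p2 q2 r2 : R) :
    p = k * p1 + p2 -> q = k * q1 + q2 -> r = k * r1 + r2 ->
    p - q + r = k * (p1 - q1 + r1) + (p2 - q2 + r2) by move=> -> -> ->; ring.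
exact: (ar _ _ _ _ _ _ _ _ _ (congr1 (fun f : V -> R^o => f a) (e b))
  (congr1 (fun f : V -> R^o => f b) (e a)) (linearP _ k c c')).
Qed.

Let dw_diff a b c x : U x -> differentiable (fun y => dw y a b c : R^o) x.
Proof.
have d p q r : U x -> differentiable (fun y => 'd (fun z => w z p q : R^o) y r : R^o) x.
  by apply: ((w_smooth p q 2%N).2 r).1.
move=> Ux; rewrite /dw /domega /dform2.
by apply: differentiableD; [apply: differentiableB|]; exact: d.
Qed.

Let dw_linear2 x : U x -> forall a c, linear (fun b => dw x a b c : R^o).
Proof.
move=> Ux a c k p q; rewrite !(dw_alt23 Ux a _ c) dw_linear3 //.
by rewrite opprD -scalerN.
Qed.

Let dw_linear1 x : U x -> forall b c, linear (fun a => dw x a b c : R^o).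
Proof.
move=> Ux a c k p q; rewrite !(dw_alt12 Ux _ a) dw_linear2 //.
by rewrite opprD -scalerN.
Qed.

Let Z := Im_delbar J g.

Let Z_linear x : U x -> forall a b, linear (Z x a b : V -> R^o).
Proof.
move=> Ux a b k c c'; rewrite /Z /Im_delbar -/dw J_linear // !dw_linear3 //.
move: (dw x _ _ _) (dw x _ _ _) (dw x _ _ _) (dw x _ _ _) (dw x _ _ _) (dw x _ _ _)
  (dw x _ _ _) (dw x _ _ _) => p1 p2 p3 p4 p5 p6 p7 p8.
by rewrite -![_ *: _ : R^o]/(_ * _ : R); ring.
Qed.

Let Z_alt12 x : U x -> forall a b c, Z x a b c = - Z x b a c.
Proof.
move=> Ux a b c; rewrite /Z /Im_delbar -/dw.
rewrite (dw_alt12 Ux (J x a) b) (dw_alt12 Ux a (J x b)) (dw_alt12 Ux a b).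
rewrite (dw_alt12 Ux (J x a) (J x b)).
move: (dw x _ _ _) (dw x _ _ _) (dw x _ _ _) (dw x _ _ _) => p1 p2 p3 p4; ring.
Qed.

Let Z_alt23 x : U x -> forall a b c, Z x a b c = - Z x a c b.
Proof.
move=> Ux a b c; rewrite /Z /Im_delbar -/dw.
rewrite (dw_alt23 Ux (J x a) b) (dw_alt23 Ux a (J x b)) (dw_alt23 Ux a b).
rewrite (dw_alt23 Ux (J x a) (J x b)).
move: (dw x _ _ _) (dw x _ _ _) (dw x _ _ _) (dw x _ _ _) => p1 p2 p3 p4; ring.
Qed.

Let Z_diff a b c x : U x -> differentiable (fun y => Z y a b c : R^o) x.
Proof.
move=> Ux.
have Jd v : differentiable (fun y => J y v) x by apply: (J_smooth v 1%N).1.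
have cd (v : V) : differentiable (fun _ : V => v) x by exact: differentiable_cst.
have d (A1 A2 A3 : V -> V) : differentiable A1 x -> differentiable A2 x ->
    differentiable A3 x -> differentiable (fun y => dw y (A1 y) (A2 y) (A3 y) : R^o) x.
  move=> h1 h2 h3.
  have := is_diff_trilinear (B := dw) oU Ux dw_linear3 dw_linear2 dw_linear1
     (fun a b c => dw_diff a b c Ux) h1 h2 h3.
  by case.
have d1 := d _ _ _ (Jd a) (cd b) (cd c); have d2 := d _ _ _ (cd a) (Jd b) (cd c).
have d3 := d _ _ _ (cd a) (cd b) (Jd c); have d4 := d _ _ _ (Jd a) (Jd b) (Jd c).
apply: (differentiableZ (2 ^+ 3)^-1).
exact: differentiableD (differentiableD (differentiableD d1 d2) d3) (differentiableZ 3 d4).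
Qed.

Variables (X : V -> V -> V) (b : V -> V -> V) (J0 : V -> V) (g0 : V -> V -> R).
Hypothesis X_diff : forall u x, U x -> differentiable (X u) x.
Hypothesis X_bracket : forall u v x, U x -> local_bracket (X u) (X v) x = X (b u v) x.
Hypothesis XJ : forall u x, U x -> J x (X u x) = X (J0 u) x.
Hypothesis Xg : forall u v x, U x -> g x (X u x) (X v x) = g0 u v.
Hypothesis bC : forall u v, b u v = - b v u.
Hypothesis J0_integrable : forall u v,
  b (J0 u) (J0 v) - J0 (b (J0 u) v) - J0 (b u (J0 v)) - b u v = 0.
Hypothesis g0_linear : forall u, linear (g0 u : V -> R^o).
Hypothesis g0C : forall u v, g0 u v = g0 v u.
Hypothesis g0J : forall u v, g0 (J0 u) (J0 v) = g0 u v.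

(** The Chevalley-Eilenberg differential of the fundamental form. *)
Let tau u v t := - g0 (J0 (b u v)) t + g0 (J0 (b u t)) v - g0 (J0 (b v t)) u.

Let dw_frame u v t x : U x -> dw x (X u x) (X v x) (X t x) = tau u v t.
Proof.
move=> Ux.
apply: (dform2_frame (w := w) (w0 := fun u v => g0 (J0 u) v) oU X_diff X_bracket u v t Ux).
- exact: w_linear.
- exact: w_linearl.
- exact: w_alt.
- by move=> a c; exact: w_diff.
- by move=> y Uy u' v'; rewrite /w /omega XJ // Xg.
Qed.

Let g0Dl p q r : g0 (p + q) r = g0 p r + g0 q r.
Proof. by rewrite !(g0C _ r); have := g0_linear r 1 p q; rewrite !scale1r. Qed.
Let g0Nl p r : g0 (- p) r = - g0 p r.
Proof. by rewrite !(g0C _ r); exact: linear_opp (g0_linear r) p. Qed.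
(** Together with [tauJJJ], this expresses that [tau] has only parts of types (2,1) and (1,2), a
    consequence of integrability: there the derivation and the pullback by [J0] agree. *)
Let tauJ u v t : tau (J0 u) v t + tau u (J0 v) t + tau u v (J0 t) = torsion b J0 g0 u v t.
Proof.
rewrite /tau /torsion !g0J.
have E p q r : g0 (b (J0 p) (J0 q)) r =
    g0 (b p q) r + g0 (J0 (b (J0 p) q)) r + g0 (J0 (b p (J0 q))) r.
  have := congr1 (g0^~ r) (J0_integrable p q); rewrite !g0Dl !g0Nl.
  have -> : g0 0 r = 0 by have := g0Nl 0 r; rewrite oppr0; lra.
  by lra.
rewrite (bC (J0 t) (J0 u)) g0Nl !E; lra.
Qed.

Let tauJJJ u v t : tau (J0 u) (J0 v) (J0 t) = torsion b J0 g0 u v t.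
Proof. by rewrite /tau /torsion !g0J (bC (J0 t) (J0 u)) g0Nl; lra. Qed.

(** The factor is [(1 + 3) / 8], from [tauJ], [tauJJJ] and the coefficients of [Im_delbar]. *)
Let Z_frame u v t x : U x ->
  Z x (X u x) (X v x) (X t x) = 2^-1 * torsion b J0 g0 u v t.
Proof.
move=> Ux; rewrite /Z /Im_delbar -/dw !XJ // !dw_frame // tauJ tauJJJ.
by field.
Qed.

Lemma dform3_Im_delbar u v t s x : U x ->
  dform3 (Im_delbar J g) x (X u x) (X v x) (X t x) (X s x)
  = 2^-1 * dtorsion b J0 g0 u v t s.
Proof.
move=> Ux; rewrite (dform3_frame (w0 := fun u v t => 2^-1 * torsion b J0 g0 u v t)
  oU X_diff X_bracket u v t s Ux Z_linear Z_alt12 Z_alt23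
  (fun a c d => Z_diff a c d Ux)).
  by rewrite /dtorsion; ring.
by move=> y Uy u' v' t'; exact: Z_frame.
Qed.

End HermitianFrame.

(** * The central series *)

Section CentralSeries.
Variables (R : realType) (n : nat) (N : lieGroup R n).
Local Notation V := 'rV[R]_n.
Local Notation I := (Defs.index (lie_atlas N)).
Variable i0 : I.
Hypothesis dom1 : dom i0 1%g.
Let e0 : V := chart i0 1%g.
Let img_e0 : img i0 e0. Proof. exact: chart_img. Qed.
Let oimg (i : I) : open (img i). Proof. exact: img_open. Qed.
Local Notation linv := (@linv R n N i0).
Local Notation lie := (@lie R n N i0).
Local Notation dcs := (@descending_central_series R n N).

Lemma span1 (A : set (vfield N)) (Y Z : vfield N) (c : R) : A Y ->
  (forall i x, img i x -> Z i x = c *: Y i x) -> vfield_span A Z.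
Proof.
move=> AY ZE; exists 1%N, (fun=> c), (fun=> Y); split=> // i x ix.
by rewrite big_ord1; exact: ZE.
Qed.

(** Passes from the descending series of vector fields to the ascending series of the Lie algebra.
    The scalar -1 below appears because the former brackets on the left and the latter on the
    right. *)
Lemma upper_central_lie k j v : dcs j (linv v) -> central_series_zero N (j + k) ->
  upper_central lie k v.
Proof.
elim: k j v => [|k IH] j v hv.
  by rewrite addn0 => /(_ _ hv i0 e0 img_e0); rewrite linv_e0.
rewrite addnS -addSn => h w; apply: IH h => /=.
apply: (@span1 _ (bracket (linv w) (linv v)) _ (-1)).
  by exists (linv w), (linv v); split => //; exact: linv_left_invariant.
move=> i x ix; rewrite bracket_linv // scaleN1r lieC.
have := linvP i0 (-1) (lie w v) 0 i x; rewrite addr0 scaleN1r => ->.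
have := linvP i0 (-1) (lie w v) (lie w v) i x.
rewrite scaleN1r addNr => e; rewrite -scaleN1r.
have -> : linv 0 i x = 0 by exact: linear0.
by rewrite addr0.
Qed.

Lemma bracketE (A B : vfield N) u v i x : img i x ->
  (forall x, img i x -> A i x = linv u i x) -> (forall x, img i x -> B i x = linv v i x) ->
  bracket A B i x = linv (lie u v) i x.
Proof.
move=> ix AE BE; rewrite -bracket_linv //; apply/esym.
apply: (near_local_bracket (@oimg i) ix).
- by move=> y iy; rewrite AE.
- by move=> y iy; rewrite BE.
- exact: linv_differentiable.
- exact: linv_differentiable.
Qed.

Lemma central_series_zero2 : (forall u v w, lie u (lie v w) = 0) ->
  central_series_zero N 2.
Proof.
move=> lie2 X [m [c [Y [YP XE]]]] i x ix; rewrite XE // big1 // => l _.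
have [A [B [Ainv [p [d [Z [ZP BE]]]] ->]]] := YP l.
have [u AE] : exists u, forall i x, img i x -> A i x = linv u i x.
  by exists (A i0 e0) => j y jy; exact: left_invariantE.
have ZE q : exists v w, forall i x, img i x -> Z q i x = linv (lie v w) i x.
  have [C [D [Cinv Dinv ->]]] := ZP q.
  exists (C i0 e0), (D i0 e0) => j y jy.
  by apply: bracketE => // z jz; exact: left_invariantE.
have [v vE] := choice ZE.
have [w wE] := choice vE.
have {}BE j y : img j y -> B j y = linv (\sum_q d q *: lie (v q) (w q)) j y.
  by move=> jy; rewrite BE // [RHS]linv_sum; apply: eq_bigr => q _; rewrite wE.
rewrite (bracketE (u := u) (v := \sum_q d q *: lie (v q) (w q)) ix) //.
- have -> : lie u (\sum_q d q *: lie (v q) (w q)) = 0.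
    pose LM := GRing.isLinear.Build _ _ _ _ _ (lie_linear dom1 u).
    pose L : {linear V -> V} := HB.pack (lie u) LM.
    rewrite -[lie u _]/(L _) linear_sum big1 // => q _.
    by rewrite linearZ /= lie2 scaler0.
  have -> : linv 0 i x = 0 by exact: linear0.
  by rewrite scaler0.
- by move=> y; exact: AE.
- by move=> y; exact: BE.
Qed.

Lemma central_series_zero1 u v : central_series_zero N 1 -> lie u v = 0.
Proof.
move=> h; apply: (h (bracket (linv u) (linv v))) => //.
apply: (@span1 _ (bracket (linv u) (linv v)) _ 1).
  by exists (linv u), (linv v); split => //; exact: linv_left_invariant.
by move=> i x ix; rewrite scale1r.
Qed.

Theorem SKT_lie_lie (J : endo_field N) (g : bilinear_field N) :
  Defs.hermitian J g -> invariant_under setT J g -> SKT J g ->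
  nilpotent_lie_group N -> forall u v w, lie u (lie v w) = 0.
Proof.
move=> [[Jl Js _ JK] Jint [gl gs _ gC g0] gJ] inv skt [k nil].
have XJ u x : img i0 x -> J i0 x (linv u i0 x) = linv (J i0 e0 u) i0 x.
  move=> ix; have [+ _] := inv (chart_inv i0 x) Logic.I.
  by move=> /(_ i0 i0 e0 (left_mul_on dom1 ix) u); rewrite rep_left_mul_e0.
have Xg u v x : img i0 x -> g i0 x (linv u i0 x) (linv v i0 x) = g i0 e0 u v.
  move=> ix; have [_] := inv (chart_inv i0 x) Logic.I.
  by move=> /(_ i0 i0 e0 (left_mul_on dom1 ix) u v); rewrite rep_left_mul_e0.
have integ u v : lie (J i0 e0 u) (J i0 e0 v) - J i0 e0 (lie (J i0 e0 u) v)
    - J i0 e0 (lie u (J i0 e0 v)) - lie u v = 0.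
  (* Only the chart [i0] is involved, so the local fields are extended to families that do not
     depend on the chart. *)
  have lb (A B : V -> V) p q : (forall x, img i0 x -> A x = linv p i0 x) ->
      (forall x, img i0 x -> B x = linv q i0 x) -> local_bracket A B e0 = lie p q.
    move=> AE BE; have := @bracketE (fun=> A) (fun=> B) p q i0 e0 img_e0 AE BE.
    by rewrite linv_e0.
  have := Jint i0 (linv u i0) (linv v i0) (linv_smooth dom1 u i0) (linv_smooth dom1 v i0).
  move=> /= /(_ e0 img_e0).
  rewrite (lb _ _ (J i0 e0 u) (J i0 e0 v) (XJ u) (XJ v)).
  rewrite (lb _ (linv v i0) (J i0 e0 u) v (XJ u) (fun x _ => erefl)).
  rewrite (lb (linv u i0) _ u (J i0 e0 v) (fun x _ => erefl) (XJ v)).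
  by rewrite (lb (linv u i0) (linv v i0) u v (fun x _ => erefl) (fun x _ => erefl)).
have dE a b c d : dform3 (Im_delbar (J i0) (g i0)) e0 a b c d
    = 2^-1 * dtorsion lie (J i0 e0) (g i0 e0) a b c d.
  rewrite -[LHS](_ : dform3 (Im_delbar (J i0) (g i0)) e0 (linv a i0 e0) (linv b i0 e0)
     (linv c i0 e0) (linv d i0 e0) = _); last by rewrite !linv_e0.
  apply: (@dform3_Im_delbar _ _ (img i0) (@oimg i0) (J i0) (g i0) _ _ _ _ _ _ _
    (fun u => linv u i0) lie (J i0 e0) (g i0 e0)) => //.
  all: try by [exact: Jl|exact: Js|exact: JK|exact: gl|exact: gs|exact: gC|exact: gJ].
  - by move=> u x; exact: linv_differentiable.
  - by move=> u v x ix; exact: bracket_linv.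
  - by move=> u v; exact: lieC.
have T2 := SKT_real (skt i0 e0 img_e0).
apply: (@bracket_bracket_eq0 R V lie (J i0 e0) (g i0 e0)) => //.
- exact: lie_linear.
- by move=> u v; exact: lieC.
- exact: lie_jacobi.
- exact: Jl.
- exact: JK.
- exact: gl.
- exact: gC.
- exact: g0.
- exact: gJ.
- move=> a b c d.
  have ar (x1 x2 x3 x4 x5 x6 x7 x8 y1 y2 y3 y4 y5 y6 y7 y8 : R) :
      x1 = 2^-1 * y1 -> x2 = 2^-1 * y2 -> x3 = 2^-1 * y3 -> x4 = 2^-1 * y4 ->
      x5 = 2^-1 * y5 -> x6 = 2^-1 * y6 -> x7 = 2^-1 * y7 -> x8 = 2^-1 * y8 ->
      6%:R * x1 + 2%:R * (x2 + x3 + x4 + x5 + x6 + x7) + 6%:R * x8 = 0 ->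
      6%:R * y1 + 2%:R * (y2 + y3 + y4 + y5 + y6 + y7) + 6%:R * y8 = 0.
    by clear; lra.
  exact: (ar _ _ _ _ _ _ _ _ _ _ _ _ _ _ _ _ (dE _ _ _ _) (dE _ _ _ _) (dE _ _ _ _)
    (dE _ _ _ _) (dE _ _ _ _) (dE _ _ _ _) (dE _ _ _ _) (dE _ _ _ _) (T2 a b c d)).
- exists k => v; apply: (@upper_central_lie k 0 v) => //.
  exact: linv_left_invariant.
Qed.

End CentralSeries.

(** * Lie groups with vanishing bracket *)

(** Level sets of [f] and their complements are open, and the image of a path is connected. *)
Lemma locally_constant (R : realType) (T : topologicalType) (T' : Type) (f : T -> T') :
  path_connected R T -> (forall p, \forall q \near p, f q = f p) ->
  forall p q, f p = f q.
Proof.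
move=> pc lc p q; have [gamma [gc g0 g1]] := pc p q.
have con : connected (gamma @` `[0, 1]).
  by apply: connected_continuous_connected gc; exact: segment_connected.
have opn (P : T' -> Prop) : open [set x | P (f x)].
  rewrite openE => x Px; rewrite /interior.
  by apply: filterS (lc x) => y /= ->.
have z0 : (gamma @` `[0, 1]) p by exists 0 => //; rewrite /= in_itv /= lexx ler01.
have z1 : (gamma @` `[0, 1]) q by exists 1 => //; rewrite /= in_itv /= lexx ler01.
have := con ((gamma @` `[0, 1]) `&` [set x | f x = f p]) _ _ _.
move=> h; have : ((gamma @` `[0, 1]) `&` [set x | f x = f p]) q.
  rewrite h //.
  - by exists p.
  - by exists [set x | f x = f p] => //; exact: (opn (fun t => t = f p)).
  - exists [set x | f x = f p] => //.
    rewrite -[X in closed X]setCK; apply: open_closedC.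
    exact: (opn (fun t => ~ (t = f p))).
by move=> [].
Qed.

Section Abelian.
Variables (R : realType) (n : nat) (N : lieGroup R n).
Local Notation V := 'rV[R]_n.
Local Notation I := (Defs.index (lie_atlas N)).
Variable i0 : I.
Hypothesis dom1 : dom i0 1%g.
Let e0 : V := chart i0 1%g.
Let img_e0 : img i0 e0. Proof. exact: chart_img. Qed.
Let inv_e0 : chart_inv i0 e0 = 1%g. Proof. exact: chartK. Qed.
Let oimg (i : I) : open (img i). Proof. exact: img_open. Qed.
Local Notation linv := (@linv R n N i0).
Local Notation lie := (@lie R n N i0).

Definition right_mul (p q : N) : N := (q * p)%g.
Definition conj_by (p q : N) : N := (p * q * p^-1)%g.

Lemma smooth_right_mul p : smooth_map (right_mul p).
Proof. exact: smooth_map_mul (smooth_map_id N) (smooth_map_cst p). Qed.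

Lemma smooth_conj_by p : smooth_map (conj_by p).
Proof.
exact: smooth_map_mul (smooth_map_mul (smooth_map_cst p) (smooth_map_id N)) (smooth_map_cst _).
Qed.

Lemma smooth_invg : smooth_map (fun p : N => p^-1)%g.
Proof. exact: smooth_map_inv (smooth_map_id N). Qed.

Let m (z : V * V) : V := chart i0 (chart_inv i0 z.1 * chart_inv i0 z.2)%g.
Let M : set (V * V) :=
  [set z | [/\ img i0 z.1, img i0 z.2 & dom i0 (chart_inv i0 z.1 * chart_inv i0 z.2)%g]].

Let open_M : open M.
Proof.
rewrite openE => z [i1 i2 d]; rewrite /interior.
have c1 : {for z, continuous (fun z : V * V => chart_inv i0 z.1)}.
  apply: (@continuous_comp _ _ _ (fst : V * V -> V) (chart_inv i0)); first exact: cvg_fst.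
  exact: chart_inv_continuous.
have c2 : {for z, continuous (fun z : V * V => chart_inv i0 z.2)}.
  apply: (@continuous_comp _ _ _ (snd : V * V -> V) (chart_inv i0)); first exact: cvg_snd.
  exact: chart_inv_continuous.
have c : {for z, continuous (fun z : V * V => chart_inv i0 z.1 * chart_inv i0 z.2)%g}.
  apply: (@continuous_comp _ _ _ (fun z : V * V => (chart_inv i0 z.1, chart_inv i0 z.2))
    (fun xy => xy.1 * xy.2)%g); first exact: cvg_pair.
  exact: mulg_continuous.
have n1 : \forall z' \near z, img i0 z'.1.
  by apply: (@cvg_fst _ _ _ _ _ (img i0)); apply: open_nbhs_nbhs; split.
have n2 : \forall z' \near z, img i0 z'.2.
  by apply: (@cvg_snd _ _ _ _ _ (img i0)); apply: open_nbhs_nbhs; split.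
have n3 : \forall z' \near z, dom i0 (chart_inv i0 z'.1 * chart_inv i0 z'.2)%g.
  by apply: c; apply: open_nbhs_nbhs; split => //; exact: dom_open.
by near=> z'; split; near: z'.
Unshelve. all: by end_near. Qed.

Let m_smooth : smooth M m. Proof. exact: mul_smooth. Qed.
Let m_diff z : M z -> differentiable m z. Proof. exact: (m_smooth 1%N).1. Qed.
Let M_e0 : M (e0, e0). Proof. by split => //=; rewrite inv_e0 mulg1. Qed.
Let M_l x : img i0 x -> M (x, e0).
Proof. by move=> ix; split => //=; rewrite inv_e0 mulg1; exact: chart_inv_dom. Qed.
Let M_r x : img i0 x -> M (e0, x).
Proof. by move=> ix; split => //=; rewrite inv_e0 mul1g; exact: chart_inv_dom. Qed.

Let rep_id (i : I) x : img i x -> is_diff x (rep (@id N) i i) id.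
Proof.
move=> ix; apply: (near_is_diff (f := id)) (is_diff_id x).
by apply: (open_near (@oimg i) ix) => y iy; rewrite /rep chart_invK.
Qed.

Let partial_l x y v : M (x, y) ->
  'd (rep (right_mul (chart_inv i0 y)) i0 i0) x v = 'd m (x, y) (v, 0).
Proof.
move=> Mz; have [_ e] := is_diff_comp (is_diff_pair (is_diff_id x) (is_diff_cst y x))
   (differentiableP (m_diff Mz)).
exact: (congr1 (fun f : V -> V => f v) e).
Qed.

Let partial_r x y v : M (x, y) ->
  'd (rep (left_mul (chart_inv i0 x)) i0 i0) y v = 'd m (x, y) (0, v).
Proof.
move=> Mz; have [_ e] := is_diff_comp (is_diff_pair (is_diff_cst x y) (is_diff_id y))
   (differentiableP (m_diff Mz)).
exact: (congr1 (fun f : V -> V => f v) e).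
Qed.

Let linvE u x : img i0 x -> linv u i0 x = 'd m (x, e0) (0, u).
Proof. by move=> ix; rewrite -(partial_r _ (M_l ix)). Qed.

Definition rinv (u x : V) : V := 'd (rep (right_mul (chart_inv i0 x)) i0 i0) e0 u.

Let rinvE u x : img i0 x -> rinv u x = 'd m (e0, x) (u, 0).
Proof. by move=> ix; rewrite -(partial_l _ (M_r ix)). Qed.

Lemma rinv_smooth u : smooth (img i0) (rinv u).
Proof.
move=> k; have [_ mc] := m_smooth k.+1.
apply: (@Ck_ext _ _ _ (@oimg i0) _ _ (fun x => 'd m (e0, x) (u, 0))).
  by move=> x ix; rewrite rinvE.
apply: (Ck_comp_rV2 (g := fun z => 'd m z (u, 0)) (@oimg i0) _ _ M_r (mc (u, 0))).
- exact: Ck_cst.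
- exact: Ck_id.
Qed.

Lemma rinv_e0 u : rinv u e0 = u.
Proof.
have [_ e] := rep_id img_e0.
rewrite /rinv inv_e0 (_ : right_mul 1%g = id); last first.
  by apply/funext => p; rewrite /right_mul mulg1.
exact: (congr1 (fun f : V -> V => f u) e).
Qed.

(** Both sides are the mixed second derivative of the multiplication at the identity, taken in the
    two orders. *)
Lemma diff_rinv u v : 'd (rinv u) e0 v = 'd (linv v i0) e0 u.
Proof.
have [_ mc] := m_smooth 2%N.
have h1 : 'd (rinv u) e0 v = 'd (fun z => 'd m z (u, 0)) (e0, e0) (0, v).
  have dg : differentiable (fun z => 'd m z (u, 0)) (e0, e0) by apply: (mc _).1.
  have h := is_diff_comp (is_diff_pair (is_diff_cst e0 e0) (is_diff_id e0)) (differentiableP dg).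
  have h' := near_is_diff (open_near (@oimg i0) img_e0 (fun x ix => esym (rinvE u ix))) h.
  have [_ e] := h'; exact: (congr1 (fun f : V -> V => f v) e).
have h2 : 'd (linv v i0) e0 u = 'd (fun z => 'd m z (0, v)) (e0, e0) (u, 0).
  have dg : differentiable (fun z => 'd m z (0, v)) (e0, e0) by apply: (mc _).1.
  have h := is_diff_comp (is_diff_pair (is_diff_id e0) (is_diff_cst e0 e0)) (differentiableP dg).
  have h' := near_is_diff (open_near (@oimg i0) img_e0 (fun x ix => esym (linvE v ix))) h.
  have [_ e] := h'; exact: (congr1 (fun f : V -> V => f u) e).
exact: etrans h1 (etrans (Schwarz (u, 0) (0, v) open_M M_e0 (m_smooth 2%N)) (esym h2)).
Qed.

Definition Ad (p : N) (v : V) : V := 'd (rep (conj_by p) i0 i0) e0 v.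

Let conj_on p : rep_on (conj_by p) i0 i0 e0.
Proof. by split; rewrite // inv_e0 /conj_by mulg1 mulgV. Qed.

Let rep_conj_e0 p : rep (conj_by p) i0 i0 e0 = e0.
Proof. by rewrite /rep inv_e0 /conj_by mulg1 mulgV. Qed.

Lemma AdM p q v : Ad (p * q)%g v = Ad p (Ad q v).
Proof.
have HE r : conj_by (p * q)%g r = conj_by p (conj_by q r).
  by rewrite /conj_by invgM !mulgA.
apply: etrans (diff_rep_comp v (smooth_conj_by q) (smooth_conj_by p) HE (conj_on q)
  (conj_on (p * q)%g).2) _.
by rewrite rep_conj_e0.
Qed.

Lemma Ad1 v : Ad 1%g v = v.
Proof.
have [_ e] := rep_id img_e0.
rewrite /Ad (_ : conj_by 1%g = id); last first.
  by apply/funext => p; rewrite /conj_by invg1 mulg1 mul1g.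
exact: (congr1 (fun f : V -> V => f v) e).
Qed.

(** Left translation by [p] is conjugation by [p] followed by right translation by [p].
    Differentiating this relation at the identity will give the derivative of [Ad]. *)
Lemma rinv_Ad v x : img i0 x -> rinv (Ad (chart_inv i0 x) v) x = linv v i0 x.
Proof.
move=> ix; set p := chart_inv i0 x.
have HE r : left_mul p r = right_mul p (conj_by p r).
  by rewrite /left_mul /right_mul /conj_by mulgVK.
apply: esym; apply: etrans (diff_rep_comp v (smooth_conj_by p) (smooth_right_mul p) HE
  (conj_on p) (left_mul_on dom1 ix).2) _.
by rewrite rep_conj_e0.
Qed.

Let Uinv : set V := rep_on (fun p : N => p^-1)%g i0 i0.
Let iota : V -> V := rep (fun p : N => p^-1)%g i0 i0.

Let AdE v x : Uinv x -> Ad (chart_inv i0 x) v = 'd m (x, iota x) (linv v i0 x, 0).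
Proof.
move=> [ix dx]; set p := chart_inv i0 x.
have HE r : conj_by p r = right_mul p^-1%g (left_mul p r) by [].
have iy : img i0 (iota x) by exact: chart_img.
have py : chart_inv i0 (iota x) = p^-1%g by rewrite /iota /rep chartK.
have Mxy : M (x, iota x) by split => //=; rewrite py mulgV.
have := partial_l (linv v i0 x) Mxy; rewrite py => <-.
apply: etrans (diff_rep_comp v (smooth_left_mul p) (smooth_right_mul p^-1%g) HE
  (left_mul_on dom1 ix) (conj_on p).2) _.
by rewrite rep_left_mul_e0.
Qed.

Let Uinv_e0 : Uinv e0. Proof. by split; rewrite // inv_e0 invg1. Qed.
Let open_Uinv : open Uinv. Proof. exact: open_rep_on smooth_invg.1. Qed.

Let Ad_differentiable v : differentiable (fun x => Ad (chart_inv i0 x) v) e0.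
Proof.
have sub : Uinv `<=` img i0 by move=> x [].
suff h : Ck 1 Uinv (fun x => 'd m (x, iota x) (linv v i0 x, 0)).
  apply: near_differentiable (h.1 e0 Uinv_e0).
  by apply: (open_near open_Uinv Uinv_e0) => x Ux; rewrite AdE.
apply: (@Ck_ext _ _ _ open_Uinv _ _
  (fun x => \sum_i linv v i0 x ord0 i *: 'd m (x, iota x) (delta_mx ord0 i, 0))).
  move=> x Ux; rewrite {2}(delta_mx_sum (linv v i0 x)).
  have -> : (\sum_i linv v i0 x ord0 i *: delta_mx ord0 i, 0) =
     \sum_i linv v i0 x ord0 i *: (delta_mx ord0 i, 0) :> V * V.
    rewrite [RHS]surjective_pairing !raddf_sum /=; congr pair.
    by rewrite big1 // => i _; rewrite scaler0.
  by rewrite linear_sum; apply: eq_bigr => i _; rewrite linearZ.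
apply: Ck_sum => // i; apply: Ck_scale => //.
  by apply: Ck_coord => //; apply: Ck_sub (linv_smooth dom1 v i0 1%N).
have mc : Ck 1 M (fun z => 'd m z (delta_mx ord0 i, 0)) by apply: (m_smooth 2%N).2.
apply: (Ck_comp_rV2 (U' := M) (f1 := fun x => x) (f2 := iota)
  (g := fun z => 'd m z (delta_mx ord0 i, 0)) open_Uinv _ _ _ mc).
- exact: Ck_id.
- exact: smooth_invg.2.
- move=> x [ix dx]; split => //=; first exact: chart_img.
  by rewrite /iota /rep chartK // mulgV.
Qed.

Hypothesis lie0 : forall u v, lie u v = 0.

(** By [rinv_Ad] and [diff_rinv], the derivative of [Ad _ v] at the identity along [w] is ['d (linv
    v i0) e0 w - 'd (linv w i0) e0 v], that is, [lie w v]. *)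
Let Ad_diff0 v : is_diff e0 (fun x => Ad (chart_inv i0 x) v) 0.
Proof.
have Ad_d := Ad_differentiable v.
apply: DiffDef => //; apply/funext => w.
have Bl : \forall x \near e0, linear (fun a => rinv a x).
  by near=> x => a p q; exact: linearP.
have Bd a : differentiable (fun y => rinv a y) e0 by apply: (rinv_smooth a 1%N).1.
have h := is_diff_bilinear (B := fun x a => rinv a x) Bl Bd Ad_d.
have h' := near_is_diff (open_near (@oimg i0) img_e0 (fun x ix => rinv_Ad v ix)) h.
have [_ e] := h'; have ew := congr1 (fun f : V -> V => f w) e.
move: ew; rewrite inv_e0 rinv_e0 => ew.
have A1 : (fun y => rinv (Ad 1%g v) y) = rinv v by rewrite Ad1.
have er : 'd (fun y => rinv (Ad 1%g v) y) e0 w = 'd (linv w i0) e0 v.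
  by rewrite A1; exact: diff_rinv.
have lw : 'd (linv v i0) e0 w - 'd (linv w i0) e0 v = 0.
  by have := lie0 w v; rewrite /lie /bracket /local_bracket !linv_e0.
have ar (p q r s : V) : p = q + r -> q = s -> p - s = 0 -> r = 0.
  by move=> -> ->; rewrite addrAC subrr add0r.
exact: ar ew er lw.
Unshelve. all: by end_near. Qed.

(** Near a point [q], [Ad p] is the fixed linear map [Ad q] composed with [Ad (q^-1 * p)], which
    brings the claim back to the identity. *)
Let Ad_diff0_chart (j : I) v x : img j x -> is_diff x (fun y => Ad (chart_inv j y) v) 0.
Proof.
move=> jx; set q := chart_inv j x; pose F := left_mul q^-1%g.
have Fx : rep_on F j i0 x by split => //; rewrite /F /left_mul mulVg.
have Fe : rep F j i0 x = e0 by rewrite /rep /F /left_mul mulVg.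
have A0 : is_diff (rep F j i0 x) (fun y => Ad (chart_inv i0 y) v) 0.
  by rewrite Fe; exact: Ad_diff0.
have h1 := is_diff_comp (differentiableP (rep_differentiable (smooth_left_mul _) Fx)) A0.
have cd : continuous ('d (rep (conj_by q) i0 i0) e0).
  by apply: diff_continuous; exact: rep_differentiable (smooth_conj_by q) (conj_on q).
have hl z : is_diff z ('d (rep (conj_by q) i0 i0) e0 : V -> V)
    ('d (rep (conj_by q) i0 i0) e0).
  exact: DiffDef (linear_differentiable z cd) (diff_lin z cd).
have h2 := is_diff_comp h1 (hl _).
have nr : \forall y \near x, (('d (rep (conj_by q) i0 i0) e0 : V -> V) \o
    ((fun y => Ad (chart_inv i0 y) v) \o rep F j i0)) y = Ad (chart_inv j y) v.
  apply: filterS (rep_near (smooth_left_mul _) Fx) => y [jy dy].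
  apply: (etrans (esym (AdM q (chart_inv i0 (rep F j i0 y)) v))).
  by congr (Ad _ v); rewrite /rep chartK // /F /left_mul mulVKg.
move: (near_is_diff nr h2) => /is_diff_eq; apply; apply/funext => w.
exact: linear0.
Qed.

Let near_chart (j : I) p (r : R) : dom j p -> 0 < r ->
  \forall q \near p, dom j q /\ ball (chart j p) r (chart j q).
Proof.
move=> jp r0; have oj : open (dom j) by exact: dom_open.
near=> q; split; near: q; first exact: open_nbhs_nbhs.
by have cc := chart_continuous jp; apply: cc; exact: nbhsx_ballx.
Unshelve. all: by end_near. Qed.

Hypothesis pathN : path_connected R N.

Lemma Ad_eq p v : Ad p v = v.
Proof.
rewrite -[RHS]Ad1; apply: (locally_constant (f := fun p => Ad p v) pathN) => {}p.
have [j jp] := chart_cover (lie_atlas N) p.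
have ip : img j (chart j p) by exact: chart_img.
have /nbhs_ballP[r /= r0 br] : nbhs (chart j p) (img j).
  by apply: open_nbhs_nbhs; split => //; exact: oimg.
apply: filterS (near_chart jp r0) => q [jq bq].
pose f y := Ad (chart_inv j y) v.
have fd y : ball (chart j p) r y -> differentiable f y.
  by move=> /br jy; have [] := Ad_diff0_chart v jy.
have f0 y w : ball (chart j p) r y -> 'd f y w = 0.
  move=> /br jy; have [_ e] := Ad_diff0_chart v jy.
  exact: (congr1 (fun h : V -> V => h w) e).
have := diff0_ball_cst fd f0 bq.
by rewrite /f (chartK jp) (chartK jq).
Qed.

(** * From the trivial adjoint representation to trivial commutators *)

Lemma diff_rep_mul (F G : N -> N) w : smooth_map F -> smooth_map G ->
  F 1%g = 1%g -> G 1%g = 1%g ->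
  'd (rep (fun p => F p * G p)%g i0 i0) e0 w
  = 'd (rep F i0 i0) e0 w + 'd (rep G i0 i0) e0 w.
Proof.
move=> sF sG F1 G1.
have onF : rep_on F i0 i0 e0 by split; rewrite // inv_e0 F1.
have onG : rep_on G i0 i0 e0 by split; rewrite // inv_e0 G1.
have F0 : rep F i0 i0 e0 = e0 by rewrite /rep inv_e0 F1.
have G0 : rep G i0 i0 e0 = e0 by rewrite /rep inv_e0 G1.
have hm : is_diff (rep F i0 i0 e0, rep G i0 i0 e0) m ('d m (e0, e0)).
  by rewrite F0 G0; apply: differentiableP; exact: m_diff.
have h := is_diff_comp (is_diff_pair (differentiableP (rep_differentiable sF onF))
  (differentiableP (rep_differentiable sG onG))) hm.
have nr : \forall y \near e0, (m \o (fun y => (rep F i0 i0 y, rep G i0 i0 y))) y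
    = rep (fun p => F p * G p)%g i0 i0 y.
  apply: filterS2 (rep_near sF onF) (rep_near sG onG) => y [_ Fy] [_ Gy].
  by rewrite /= /m /= /rep !chartK.
have [_ e] := near_is_diff nr h.
have split u v : 'd m (e0, e0) (u, v) = u + v.
  have -> : (u, v) = (u, 0) + (0, v) :> V * V.
    by rewrite [RHS]surjective_pairing /= addr0 add0r.
  have eu := etrans (esym (rinvE u img_e0)) (rinv_e0 u).
  have ev := etrans (esym (linvE v img_e0)) (linv_e0 dom1 v).
  exact: etrans (linearD _ _ _) (congr2 (fun p q : V => p + q) eu ev).
exact: etrans (congr1 (fun f : V -> V => f w) e) (split _ _).
Qed.

(** The commutator [p a^-1 p^-1 a], written as a product of two maps fixing the identity; their
    differentials there are opposite because [Ad] is trivial. *)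
Let theta (a p : N) : N := (p * conj_by a^-1 p^-1)%g.

Let smooth_theta a : smooth_map (theta a).
Proof.
apply: smooth_map_mul; first exact: smooth_map_id.
exact: smooth_map_mul (smooth_map_mul (smooth_map_cst _) smooth_invg) (smooth_map_cst _).
Qed.

Let theta1 a : theta a 1%g = 1%g.
Proof. by rewrite /theta /conj_by invg1 mulg1 mul1g mulgV. Qed.

Let diff_theta a w : 'd (rep (theta a) i0 i0) e0 w = 0.
Proof.
have V1 : (1%g : N)^-1%g = 1%g := invg1 _.
have on1 : rep_on (fun p : N => p^-1)%g i0 i0 e0 by exact: Uinv_e0.
have rV : rep (fun p : N => p^-1)%g i0 i0 e0 = e0 by rewrite /rep inv_e0 invg1.
have dV : w + 'd (rep (fun p : N => p^-1)%g i0 i0) e0 w = 0.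
  have := diff_rep_mul w (smooth_map_id N) smooth_invg erefl V1.
  have [_ eid] := rep_id img_e0.
  have -> : (fun p : N => id p * p^-1)%g = (fun=> 1%g).
    by apply/funext => p; rewrite /= mulgV.
  have -> : rep (fun=> 1%g : N) i0 i0 = cst e0 by [].
  move=> h; have c0 := congr1 (fun f : V -> V => f w) (diff_cst e0 e0).
  have hid := congr1 (fun f : V -> V => f w) eid.
  exact: etrans (esym (congr1 (fun z : V => z + _) hid)) (etrans (esym h) c0).
have s2 : smooth_map (fun p => conj_by a^-1 p^-1)%g.
  exact: smooth_map_mul (smooth_map_mul (smooth_map_cst _) smooth_invg) (smooth_map_cst _).
have k1 : conj_by a^-1%g (1%g)^-1%g = 1%g by rewrite /conj_by invg1 mulg1 mulgV.
apply: etrans (diff_rep_mul w (smooth_map_id N) s2 erefl k1) _.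
have [_ eid] := rep_id img_e0.
have hid := congr1 (fun f : V -> V => f w) eid.
have d1 : dom i0 (conj_by a^-1%g (chart_inv i0 e0)^-1%g) by rewrite inv_e0 k1.
have h2 := diff_rep_comp (H := fun p => conj_by a^-1%g p^-1%g) w smooth_invg
  (smooth_conj_by a^-1%g) (fun=> erefl) on1 d1.
have h3 : 'd (rep (fun p => conj_by a^-1%g p^-1%g) i0 i0) e0 w =
   'd (rep (fun p : N => p^-1)%g i0 i0) e0 w.
  by apply: etrans h2 _; rewrite rV; exact: Ad_eq.
exact: etrans (congr2 (fun p q : V => p + q) hid h3) dV.
Qed.

Lemma abelian_lie_group : abelian_group N.
Proof.
move=> a b; pose psi (p : N) : N := (a * p * a^-1 * p^-1)%g.
have s_psi : smooth_map psi.
  by do 2?apply: smooth_map_mul; [exact: smooth_left_mul|exact: smooth_map_cst|exact: smooth_invg].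
have d_psi j k y v : rep_on psi j k y -> 'd (rep psi j k) y v = 0.
  move=> [jy ky]; set q := chart_inv j y in ky.
  pose L (t : N) : N := (a * q * t * (a^-1 * q^-1))%g.
  have sL : smooth_map L.
    exact: smooth_map_mul (smooth_left_mul _) (smooth_map_cst _).
  have sLt : smooth_map (fun t => L (theta a t)).
    apply: smooth_map_mul; last exact: smooth_map_cst.
    exact: smooth_map_mul (smooth_map_cst _) (smooth_theta a).
  (* Writing [p = q t] gives [psi p = a q (t a^-1 t^-1 a) a^-1 q^-1], which moves the differential
     at [q] to that of [theta a] at the identity. *)
  have HE p : psi p = L (theta a (left_mul q^-1%g p)).
    rewrite /psi /L /theta /conj_by /left_mul !invgM !invgK !mulgA.
    by rewrite !mulgK.
  have Fy : rep_on (left_mul q^-1%g) j i0 y by split => //; rewrite /left_mul mulVg.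
  have Fe : rep (left_mul q^-1%g) j i0 y = e0 by rewrite /rep /left_mul mulVg.
  have onT : rep_on (theta a) i0 i0 e0 by split; rewrite // inv_e0 theta1.
  have h1 := diff_rep_comp v (smooth_left_mul q^-1%g) sLt HE Fy ky.
  have kL : dom k (L (theta a (chart_inv i0 e0))).
    by move: ky; rewrite HE /left_mul mulVg inv_e0.
  have hz w : 'd (rep (fun t => L (theta a t)) i0 k) e0 w = 0.
    apply: etrans (diff_rep_comp w (smooth_theta a) sL (fun=> erefl) onT kL) _.
    by apply: etrans (congr1 _ (diff_theta a w)) _; exact: linear0.
  by apply: etrans h1 _; rewrite Fe; exact: hz.
have lc p : \forall q \near p, psi q = psi p.
  have [j jp] := chart_cover (lie_atlas N) p.
  have [k kp] := chart_cover (lie_atlas N) (psi p).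
  have on : rep_on psi j k (chart j p) by split; [exact: chart_img|rewrite chartK].
  have /nbhs_ballP[r /= r0 br] := rep_near s_psi on.
  have nr := near_chart jp r0.
  apply: filterS nr => q [jq bq].
  have := @diff0_ball_cst R n _ (rep psi j k) (chart j p) r.
  move=> /(_ _ _ _ bq) h.
  have [_ kq] := br _ bq.
  have E : rep psi j k (chart j q) = rep psi j k (chart j p).
    apply: h; first by move=> y /br; exact: rep_differentiable.
    by move=> y v /br; exact: d_psi.
  move: E kq; rewrite /rep !chartK // => E kq.
  by rewrite -(chartK kq) E chartK.
have := locally_constant pathN lc b 1%g.
rewrite /psi mulg1 invg1 mulg1 mulgV => /(congr1 (fun x => x * b * a)%g).
by rewrite mul1g mulgVK mulgVK.
Qed.

End Abelian.

Theorem theorem1p2 (R : realType) (n : nat) (N : lieGroup R n)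
    (Gamma : subgroup N) :
  simply_connected R N -> nilpotent_lie_group N -> cocompact_lattice Gamma ->
  admits_invariant_SKT Gamma ->
  abelian_group N \/ step_nilpotent N 2.
Proof.
move=> [pathN _] nil _ [J [g [[herm _] inv skt]]].
have [i0 dom1] := chart_cover (lie_atlas N) 1%g.
have lie2 := SKT_lie_lie dom1 herm inv skt nil.
(* [step_nilpotent N 2] also demands that the first term of the series be non-zero; its vanishing is
   the abelian case. *)
have [h1|h1] := pselect (central_series_zero N 1); last first.
  by right; split=> //; exact: (central_series_zero2 dom1).
left; apply: (abelian_lie_group dom1 _ pathN) => u v.
exact: central_series_zero1.
Qed.
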